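(* Let $n\in\mathbb{N}$ be even. Then every regular $K_4$-free graph $G$ on $n$ vertices can be made bipartite by removing at most $n^2/9$ edges in such a way that each part has size exactly $n/2$; that is, there is a partition $V(G)=A\cup B$ with $|A|=|B|=n/2$ such that the total number of edges of $G$ lying inside $A$ or inside $B$ is at most $n^2/9$.
   Context: All graphs are finite and simple. A graph is $K_4$-free if it does not contain $K_4$ as a subgraph. *)

(* Defs.v *)
From mathcomp Require Import all_boot all_order all_algebra.

Set Implicit Arguments.
Unset Strict Implicit.
Unset Printing Implicit Defensive.

Record sgraph (T : finType) := SGraph {
  adj :> rel T;
  adj_sym : symmetric adj;
  adj_irrefl : irreflexive adj
}.

Section Graphs.
Variables (T : finType) (G : sgraph T).

(* Each undirected edge is counted once, as the two-element set of its ends. *)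
Definition edges : {set {set T}} :=
  [set E : {set T} | [exists x, exists y, G x y && (E == [set x; y])]].

Definition degree (x : T) : nat := #|[set y | G x y]|.

Definition regular : Prop := exists d : nat, forall x : T, degree x = d.

Definition contains_K4 : Prop :=
  exists f : 'I_4 -> T,
    injective f /\ (forall i j : 'I_4, i != j -> G (f i) (f j)).

Definition K4_free : Prop := ~ contains_K4.

Definition edges_inside (A : {set T}) : {set {set T}} :=
  [set E in edges | E \subset A].

End Graphs.

(* Main.v *)
Require Import Defs.
From mathcomp Require Import all_boot all_order all_algebra ring lra zify.
From mathcomp Require Import realalg.

(** A weight [f : T -> [0, 1]] of total mass [n / 2] can be rounded to a set of [n / 2] vertices
    without increasing the number of edges it spans, because the form is concave in the direction
    that moves mass from one vertex to another; by regularity, a half and its complement span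
    equally many edges. So it is enough to find a weight with [form f f <= n ^ 2 / 9]. The
    constant weight does it when the degree [d] is at most [4 * n / 9].

    Otherwise take an edge [u v] with the most common neighbours. The neighbourhood [U] of [u] is
    triangle-free. Let [P] be the neighbours of [v] in [U], let [w] in [P] have the largest degree
    inside [U], and let [Q] be the neighbours of [w] in [U]. The sets [P] and [Q] are
    independent, and [U] is cut by sending every remaining vertex of [U] to the side on which it
    has fewer neighbours in [P] and [Q]. If every weight fails, then so do the uniform weight on
    [U] (equal to [1] on [U] and constant outside [U] if [d < n / 2]), the weight equal to [1] on one side and constant on the other one, and the weight equal to
    [1] on one side, [0] on the other one and constant outside [U]. The first ones force [U] to be
    almost complete bipartite, and the last one forbids it. For intermediate densities the bounds
    meet only because an odd wheel centred at [u] forces [P] to be large. *)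

Set Implicit Arguments.
Unset Strict Implicit.
Unset Printing Implicit Defensive.

Import Order.TTheory GRing.Theory Num.Theory.
Local Open Scope ring_scope.

(** * The inequalities for the normalised parameters *)

(** With [b] and [y] replaced by their bounds, the cubic in [t] lies below its tangent line at
    [tau]; the gap is [(t - tau) ^ 2 * (t + 2 * tau - 4 * A)]. The last hypothesis puts this line
    below [psi * (1/2 - c - t)], and the positive factor cancels. *)
Lemma cubic_bound (R : realFieldType) (t G b y A Y c tau : R) :
  0 <= t -> t < 1/2 - c -> 0 <= b -> b <= 4 * A -> y <= Y ->
  (1/2 - c - t) * G <= t * (b * t + y + b ^+ 2 / 4 - t ^+ 2) ->
  2 * A <= tau ->
  2 * tau ^+ 2 * (tau - 2 * A) <=
    (3 * tau ^+ 2 - 8 * A * tau - Y - 4 * A ^+ 2) * (1/2 - c) ->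
  G <= 3 * tau ^+ 2 - 8 * A * tau - Y - 4 * A ^+ 2.
Proof.
move=> t0 tc b0 bA yY H tauA Hpsi.
set psi := (X in G <= X); rewrite -/psi in Hpsi.
have Hb : b ^+ 2 / 4 <= 4 * A ^+ 2 by nra.
have H1 : t * (b * t + y + b ^+ 2 / 4 - t ^+ 2) <=
          t * (4 * A * t + Y + 4 * A ^+ 2 - t ^+ 2).
  apply: ler_wpM2l => //; have := ler_wpM2r t0 bA; lra.
have H2 : t * (4 * A * t + Y + 4 * A ^+ 2 - t ^+ 2) <=
          - psi * t + 2 * tau ^+ 2 * (tau - 2 * A).
  have : 0 <= (t - tau) ^+ 2 * (t + 2 * tau - 4 * A).
    by apply: mulr_ge0; [exact: sqr_ge0 | lra].
  rewrite /psi; nra.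
have H3 : (1/2 - c - t) * (G - psi) <= 0 by lra.
by move: H3; rewrite pmulr_rle0 ?subr_le0 // subr_gt0.
Qed.

(** A crude bound that makes the factor [1/2 - c - t] of [cubic_bound] positive. *)
Lemma sqrt_product_small (R : realFieldType) (t b y G : R) :
  0 <= t -> 0 <= b -> b <= 1/7 -> y <= 1/30 -> G <= b * t ->
  t ^+ 2 <= y + b ^+ 2 / 4 + G -> t < 1/3.
Proof.
move=> t0 b0 b1 y1 Gbt H; rewrite ltNge; apply/negP => t1.
have : b * t <= 1/7 * t by exact: ler_wpM2r.
nra.
Qed.

(* The cross term is absorbed via [(G / 2 - t * (1 / 2 - p)) ^+ 2 >= 0]. *)
Lemma recenter (R : realFieldType) (t b p e G c : R) :
  0 <= t -> 0 <= G -> G <= b * t -> b <= 4 * c ->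
  (p - t) * G <= t * (b * t + (p * (1 - p) - e) + b ^+ 2 / 4 - t ^+ 2) ->
  (1/2 - c - t) * G <= t * (b * t + (1/4 - e) + b ^+ 2 / 4 - t ^+ 2).
Proof.
move=> t0 G0 Gbt bc H.
have [t1|t1] : t = 0 \/ 0 < t by move: t0; rewrite le_eqVlt => /orP[/eqP|]; auto.
  have -> : G = 0 by rewrite t1 in Gbt; lra.
  by rewrite t1; lra.
have xb : 0 <= (c - b / 4) * G by apply: mulr_ge0 => //; lra.
suff : 0 <= b / 4 * G - (1/2 - p) * G + t * (1/2 - p) ^+ 2 by lra.
rewrite -(pmulr_rge0 _ t1).
have : 0 <= (G / 2 - t * (1/2 - p)) ^+ 2 by exact: sqr_ge0.
have : 0 <= (b * t - G) * G by apply: mulr_ge0 => //; lra.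
nra.
Qed.

Lemma rest_le (R : realFieldType) (b p x : R) :
  0 <= x -> x <= 1/8 -> 1/2 - 2 * x <= p -> p <= 1 ->
  b * p <= 2 * (p * (1 - p) - (1/4 - x)) -> b <= 4 * (x + 2 * x ^+ 2).
Proof.
move=> x0 x1 p1 p2 H.
have p0 : 0 < p by lra.
rewrite -(ler_pM2r p0); apply: (le_trans H).
have : 0 <= (x - (1/2 - p)) ^+ 2 by exact: sqr_ge0.
have : 0 <= x ^+ 2 * (1 - 4 * (1/2 - p)).
  by apply: mulr_ge0; [exact: sqr_ge0 | lra].
lra.
Qed.

(** For [s1 = s2], a quarter of the sum of the two tests is the claim without its last term. An
    imbalance [w = s2 - s1] lowers the terms in [D] by an order of [w ^ 2] and raises the others by
    an order of [g * w]; completing the square costs [g ^ 2 / 4]. *)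
Lemma combine_cut_tests (R : realFieldType) (k s1 s2 i1 i2 D : R) :
  3/4 <= k -> k <= 1 -> 0 < s1 -> s1 <= s2 -> s1 + s2 = 1 ->
  0 <= i1 -> 0 <= i2 -> 1/5 <= D -> D <= s1 * s2 ->
  4 * k ^+ 2 / 9 < i1 + 2 * ((k - s1) / s2) * D + ((k - s1) / s2) ^+ 2 * i2 ->
  4 * k ^+ 2 / 9 < i2 + 2 * ((k - s2) / s1) * D + ((k - s2) / s1) ^+ 2 * i1 ->
  2 * k ^+ 2 / 9 < (D + (i1 + i2) / 2) * (2 * k - 1) + (i1 + i2) * (1 - k) ^+ 2
                   + ((i1 + i2) / 2) ^+ 2 / 4.
Proof.
move=> k1 k2 s1p s12 s1s2 i10 i20 D1 Ds H1 H2.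
have s2p : 0 < s2 by lra.
pose u := s1^-1; pose v := s2^-1.
have us : u * s1 = 1 by rewrite mulVf // lt0r_neq0.
have vs : v * s2 = 1 by rewrite mulVf // lt0r_neq0.
have u0 : 0 < u by rewrite invr_gt0.
have v0 : 0 < v by rewrite invr_gt0.
have s1l : 27/100 <= s1 by rewrite leNgt; apply/negP => hs; nra.
have u4 : u <= 4 by nra.
have v1 : 1 <= v by nra.
have u2 : 2 <= u by nra.
pose z := 1 - k.
have E1 : (k - s1) / s2 = 1 - z * v.
  by rewrite -/v (_ : k - s1 = s2 - z) ?mulrBl ?[s2 * v]mulrC ?vs // /z; lra.
have E2 : (k - s2) / s1 = 1 - z * u.
  by rewrite -/u (_ : k - s2 = s1 - z) ?mulrBl ?[s1 * u]mulrC ?us // /z; lra.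
rewrite E1 in H1; rewrite E2 in H2.
have z0 : 0 <= z by rewrite /z; lra.
have z1 : z <= 1/4 by rewrite /z; lra.
have Ez : k = 1 - z by rewrite /z; lra.
rewrite Ez in H1 H2 *.
have zu : z * u <= 1 by nra.
pose g := (i1 + i2) / 2.
pose w := s2 - s1.
have w0 : 0 <= w by rewrite /w; lra.
have uv : 4 * w ^+ 2 <= u + v - 4.
  have uv1 : u * v * (s1 * s2) = 1 by rewrite mulrACA us vs mulr1.
  have uvE : u + v = u * v.
    have : u * v * (s1 + s2) = v * (u * s1) + u * (v * s2) by ring.
    by rewrite us vs s1s2; lra.
  have uv4 : 4 <= u * v by nra.
  have w2 : w ^+ 2 = (s1 + s2) ^+ 2 - 4 * (s1 * s2) by rewrite /w; ring.
  have -> : u + v - 4 = u * v * w ^+ 2.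
    have -> : u * v * w ^+ 2 = u * v - 4 * (u * v * (s1 * s2)).
      by rewrite w2 s1s2; ring.
    by rewrite uv1 uvE; lra.
  by apply: ler_wpM2r; [exact: sqr_ge0 |].
have v2 : 2 - v <= 2 * w by rewrite /w; nra.
have T1 : 0 <= i1 * ((u - 2) * (2 - 2 * z - z * u)).
  by apply: mulr_ge0 => //; apply: mulr_ge0; lra.
have T2 : i2 * ((2 - v) * (2 - 2 * z - z * v)) <= 2 * g * (2 * w * (2 - 3 * z)).
  apply: ler_pM => //; last 2 first.
  - by rewrite /g; lra.
  - by apply: ler_pM => //; nra.
  by apply: mulr_ge0; nra.
have T3 : 0 <= z * (2 * D * (u + v - 4) - 8/5 * w ^+ 2).
  by apply: mulr_ge0 => //; nra.
(* The maximum is [32/81], at [z = 2/9]; the bound [2/5] makes the discriminant of the quadratic in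
   [T4] nonpositive. *)
have Fz : z * (2 - 3 * z) ^+ 2 <= 2/5.
  have : 0 <= (z - 2/9) ^+ 2 * (8/9 - z) by apply: mulr_ge0; [exact: sqr_ge0 | lra].
  lra.
have T4 : 0 <= z * (8/5 * w ^+ 2 - 2 * g * (2 * w * (2 - 3 * z))) + g ^+ 2.
  have : 0 <= (g - 2 * (2 - 3 * z) * z * w) ^+ 2 by exact: sqr_ge0.
  have : 0 <= z * w ^+ 2 * (8/5 - 4 * (z * (2 - 3 * z) ^+ 2)).
    by apply: mulr_ge0; [apply: mulr_ge0 => //; exact: sqr_ge0 | lra].
  lra.
have T5 := mulr_ge0 z0 T1.
have T6 := ler_wpM2l z0 T2.
rewrite -/g (_ : i1 + i2 = 2 * g); last by rewrite /g; lra.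
have i1E : i1 = 2 * g - i2 by rewrite /g; lra.
rewrite i1E in H1 H2 T5.
lra.
Qed.

(** The weight outside is [(1 + r) / 2], where [r] measures the imbalance of the sides. It
    contributes at most [- 2 * r * (i1 - i2) - r ^ 2], which never exceeds [(i1 - i2) ^ 2], hence
    [(i1 + i2) ^ 2]. *)
Lemma combine_outside_test (R : realFieldType) (k s1 s2 i1 i2 D : R) :
  3/4 <= k -> s1 + s2 = 1 -> 0 <= i1 -> 0 <= i2 -> i1 + i2 + 2 * D <= 1/2 ->
  4 * k ^+ 2 / 9 < i1 + 2 * ((k - s1) / (2 * k - 1)) * (s1 - i1 - D)
    + ((k - s1) / (2 * k - 1)) ^+ 2 * (2 * k - 2 + (i1 + i2 + 2 * D)) ->
  2 * D - (i1 + i2) - (i1 + i2) ^+ 2 < 2 * k - 16 * k ^+ 2 / 9.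
Proof.
move=> k1 s12 i10 i20 Dh.
pose r := (1 - 2 * s1) / (2 * k - 1).
have k0 : 2 * k - 1 != 0 by rewrite lt0r_neq0 //; lra.
have rE : r * (2 * k - 1) = 1 - 2 * s1 by rewrite /r divfK.
have -> : (k - s1) / (2 * k - 1) = (1 + r) / 2 by rewrite /r; field; rewrite k0.
move=> H.
have ->: 2 * D - (i1 + i2) = i1 + i2 + 2 * D - 2 * (i1 + i2) by lra.
have s1E : s1 = (1 - r * (2 * k - 1)) / 2 by lra.
rewrite s1E in H.
have c0 : 1 <= 2 * k - (i1 + i2 + 2 * D) by lra.
have H' : 16 * k ^+ 2 / 9 - 2 * k < i1 + i2 - 2 * D - 2 * r * (i1 - i2)
    - r ^+ 2 * (2 * k - (i1 + i2 + 2 * D)) by lra.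
have c1 : 0 <= r ^+ 2 * (2 * k - (i1 + i2 + 2 * D) - 1).
  by apply: mulr_ge0; [exact: sqr_ge0 | lra].
have c2 : 0 <= (r + (i1 - i2)) ^+ 2 by exact: sqr_ge0.
have c3 : 0 <= i1 * i2 by exact: mulr_ge0.
lra.
Qed.

Lemma sparse_nbhd (R : realFieldType) (k e : R) :
  1 <= k -> k <= 9/8 ->
  4 * k ^+ 2 / 9 < 2 * e + 2 * ((k - 1) / (2 * k - 1)) * (1 - 2 * e)
    + ((k - 1) / (2 * k - 1)) ^+ 2 * (2 * k - 2 + 2 * e) ->
  217/1000 < e.
Proof.
move=> k1 k2.
have k0 : 2 * k - 1 != 0 by rewrite lt0r_neq0 //; lra.
set r := (k - 1) / (2 * k - 1).
have rE : r * (2 * k - 1) = k - 1 by rewrite /r divfK.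
move=> H; rewrite ltNge; apply/negP => he.
have r0 : 0 <= r by nra.
have r1 : r <= 1/10 by nra.
(* So [k = (1 - r) / (1 - 2 * r)], and the test becomes a polynomial inequality in [r] alone. *)
have kk : k * (1 - 2 * r) = 1 - r by lra.
have he' : 0 <= (217/1000 - e) * (1 - r) ^+ 2.
  by apply: mulr_ge0; [lra | exact: sqr_ge0].
have H1 : 4 / 9 * k ^+ 2 < 434/1000 * (1 - r) ^+ 2 + 2 * r + 2 * r ^+ 2 * (k - 1).
  by lra.
have q0 : 0 < (1 - 2 * r) ^+ 2 by rewrite exprn_gt0; lra.
have H2 : 4 / 9 * (1 - r) ^+ 2 < 434/1000 * ((1 - r) * (1 - 2 * r)) ^+ 2
    + 2 * r * (1 - 2 * r) ^+ 2 + 2 * r ^+ 3 * (1 - 2 * r).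
  rewrite -{1}kk; move: H1; rewrite -(ltr_pM2r q0).
  have : r ^+ 2 * (k * (1 - 2 * r)) * (1 - 2 * r) = r ^+ 2 * (1 - r) * (1 - 2 * r).
    by rewrite kk.
  lra.
(* The polynomial inequality is tightest near [r = 61/1000]. *)
have : 0 <= (r - 61/1000) ^+ 2 by exact: sqr_ge0.
have : 0 <= r ^+ 2 * (1/10 - r) by apply: mulr_ge0; [exact: sqr_ge0 | lra].
have : 0 <= r ^+ 4 by rewrite exprn_ge0.
lra.
Qed.

(* With the degree scaled to [1]: [k = n / 2], [e] is the number of edges in [N(u)], [p] and [b] are
   the sizes of [P] and of the rest, [t ^ 2] is the largest product of the degrees of a vertex of
   the rest into [P] and [Q], [G] is the sum of the smaller ones, and [g] is the number of edges
   inside the two sides of the cut. *)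
Record cut_profile (R : realFieldType) (k e b p t G g : R) : Prop := CutProfile {
  cp_e : e <= 1/4;
  cp_p : 2 * e <= p;
  cp_p1 : p <= 1;
  cp_y : e <= p * (1 - p);
  cp_b0 : 0 <= b;
  cp_b : b * p <= 2 * (p * (1 - p) - e);
  cp_t0 : 0 <= t;
  cp_G0 : 0 <= G;
  cp_Gbt : G <= b * t;
  cp_t : t ^+ 2 <= p * (1 - p) - e + b ^+ 2 / 4 + G;
  cp_G : (p - t) * G <= t * (b * t + (p * (1 - p) - e) + b ^+ 2 / 4 - t ^+ 2);
  cp_g0 : 0 <= g;
  cp_g : g <= G + b ^+ 2 / 4;
  cp_wheel : 0 < G -> 11/5 - 2 * k <= p }.

(** * Bounds on the parameters of a cut profile *)

Lemma profile_b (R : realFieldType) (k e b p t G g X : R) :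
  cut_profile k e b p t G g -> 1/4 - e <= X -> X <= 1/8 ->
  b <= 4 * (X + 2 * X ^+ 2).
Proof.
move=> H eX X1.
apply: (rest_le (p := p)) => //; [have := cp_e H | have := cp_p H | exact: cp_p1 H |];
  try lra.
by have := cp_b H; lra.
Qed.

(** Here [p] may lie below [1/2]; [recenter] replaces it by [1/2] at the cost of lowering the factor
    [p - t] to [1/2 - A - t]. *)
Lemma profile_g_low (R : realFieldType) (k e b p t G g X A tau : R) :
  cut_profile k e b p t G g -> 1/4 - e <= X -> X <= 1/30 ->
  A = X + 2 * X ^+ 2 -> A <= 1/28 -> 2 * A <= tau ->
  2 * tau ^+ 2 * (tau - 2 * A) <=
    (3 * tau ^+ 2 - 8 * A * tau - X - 4 * A ^+ 2) * (1/2 - A) ->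
  g <= 3 * tau ^+ 2 - 8 * A * tau - X.
Proof.
move=> H eX X1 AE A1 tauA Hpsi.
have bA : b <= 4 * A by rewrite AE; apply: (profile_b H) => //; lra.
have b0 := cp_b0 H.
have y1 : p * (1 - p) - e <= 1/4 - e.
  by have : 0 <= (p - 1/2) ^+ 2 by [exact: sqr_ge0]; lra.
have t1 : t < 1/3.
  apply: (@sqrt_product_small _ t b (p * (1 - p) - e) G) => //; try exact: (cp_t0 H); try lra.
  - exact: cp_Gbt H.
  - exact: cp_t H.
have HG := recenter (cp_t0 H) (cp_G0 H) (cp_Gbt H) bA (cp_G H).
have b2 : b ^+ 2 / 4 <= 4 * A ^+ 2 by nra.
have := cubic_bound (cp_t0 H) _ b0 bA eX HG tauA Hpsi.
have := cp_g H; move=> Hg /(_ ltac:(lra)); lra.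
Qed.

(** The wheel bound gives [p - 1/2 >= 11/5 - 1/2 - 2 * k], and
    [p * (1 - p) = 1/4 - (p - 1/2) ^ 2]. *)
Lemma profile_y (R : realFieldType) (k e b p t G g k2 X : R) :
  cut_profile k e b p t G g -> 0 < G -> k <= k2 -> k2 <= 85/100 -> 1/4 - e <= X ->
  1/2 <= p /\ p * (1 - p) - e <= X - (17/10 - 2 * k2) ^+ 2.
Proof.
move=> H G0 kk2 k2l eX.
have p2 : 17/10 - 2 * k2 <= p - 1/2 by have := cp_wheel H G0; lra.
have : (17/10 - 2 * k2) ^+ 2 <= (p - 1/2) ^+ 2 by rewrite ler_sqr ?nnegrE; lra.
by split; lra.
Qed.

(** Since the wheel gives [p >= 1/2], [cubic_bound] applies directly with [c = 0], and [b <= 4 * Y]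
    comes from [cp_b]. *)
Lemma profile_g_high (R : realFieldType) (k e b p t G g k2 X Y tau : R) :
  cut_profile k e b p t G g -> 0 < G -> k <= k2 -> k2 <= 85/100 ->
  1/4 - e <= X -> Y = X - (17/10 - 2 * k2) ^+ 2 -> Y <= 1/32 -> 2 * Y <= tau ->
  2 * tau ^+ 2 * (tau - 2 * Y) <=
    (3 * tau ^+ 2 - 8 * Y * tau - Y - 4 * Y ^+ 2) * (1/2 - 0) ->
  g <= 3 * tau ^+ 2 - 8 * Y * tau - Y.
Proof.
move=> H G0 kk2 k2l eX YE Y1 tauY Hpsi.
have [p2] := profile_y H G0 kk2 k2l eX; rewrite -YE => y1.
have y0 : 0 <= p * (1 - p) - e by have := cp_y H; lra.
have b0 := cp_b0 H.
have bY : b <= 4 * Y by have := cp_b H; nra.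
have t1 : t < 1/3.
  apply: (@sqrt_product_small _ t b (p * (1 - p) - e) G) => //; try exact: (cp_t0 H); try lra.
  - exact: cp_Gbt H.
  - exact: cp_t H.
have HG : (1/2 - 0 - t) * G <= t * (b * t + (p * (1 - p) - e) + b ^+ 2 / 4 - t ^+ 2).
  by apply: le_trans (cp_G H); apply: ler_wpM2r; [exact: ltW | lra].
have b2 : b ^+ 2 / 4 <= 4 * Y ^+ 2 by nra.
have := cubic_bound (cp_t0 H) _ b0 bY y1 HG tauY Hpsi.
have := cp_g H; move=> Hg /(_ ltac:(lra)) HG'; lra.
Qed.

(** For [X <= 1/36], [(1/4 - X) * (2 * k - 1) - 2 * k ^ 2 / 9] increases on [k <= 1], so its value
    at [k2] decides. *)
Lemma density_upper (R : realFieldType) (k e g k1 k2 g0 X : R) :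
  k1 <= k -> k <= k2 -> k2 <= 1 -> 0 <= g -> g <= g0 -> X <= 1/36 ->
  2 * k ^+ 2 / 9 < e * (2 * k - 1) + 2 * g * (1 - k) ^+ 2 + g ^+ 2 / 4 ->
  3/4 <= k1 ->
  (1/4 - X) * (2 * k2 - 1) + 2 * g0 * (1 - k1) ^+ 2 + g0 ^+ 2 / 4 <= 2 * k2 ^+ 2 / 9 ->
  1/4 - e <= X.
Proof.
move=> kk1 kk2 k21 gp gg X1 H k1l Hn; rewrite leNgt; apply/negP => eX.
have : g * (1 - k) ^+ 2 <= g0 * (1 - k1) ^+ 2.
  by apply: ler_pM => //; rewrite ?sqr_ge0 // ler_sqr ?nnegrE; lra.
have : g ^+ 2 <= g0 ^+ 2 by rewrite ler_sqr ?nnegrE; lra.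
have : e * (2 * k - 1) <= (1/4 - X) * (2 * k - 1) by apply: ler_wpM2r; lra.
have : 0 <= (k2 - k) * ((1/4 - X) * 2 - 2 / 9 * (k2 + k)) by apply: mulr_ge0; lra.
lra.
Qed.

(** [2 * k - 16 * k ^ 2 / 9] decreases for [k >= 9/16], so the left end [k1] decides. *)
Lemma out_contra (R : realFieldType) (k e g k1 X g1 : R) :
  2 * e - 4 * g - 4 * g ^+ 2 < 2 * k - 16 * k ^+ 2 / 9 ->
  3/4 <= k1 -> k1 <= k -> 0 <= g -> g <= g1 -> 1/4 - e <= X ->
  2 * k1 - 16 * k1 ^+ 2 / 9 <= 1/2 - 2 * X - 4 * g1 - 4 * g1 ^+ 2 -> False.
Proof.
move=> H k1l kk1 g0 gg eX Hn.
have : g ^+ 2 <= g1 ^+ 2 by rewrite ler_sqr ?nnegrE; lra.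
have : 0 <= (k - k1) * (16 / 9 * (k + k1) - 2) by apply: mulr_ge0; lra.
lra.
Qed.

(** Both tests are tight at [k = 3/4], [e = 1/4]: with [j = k - 3/4] and [x = 1/4 - e] they say
    [x < j / 3] and [x > j / 3] to first order. As [G = 0], [g] is at most quadratic in [x], and the
    second-order terms decide. *)
Lemma flat_case (R : realFieldType) (k e g b p t : R) :
  cut_profile k e b p t 0 g -> 3/4 <= k -> k <= 1 -> 2/9 <= e ->
  2 * e - 4 * g - 4 * g ^+ 2 < 2 * k - 16 * k ^+ 2 / 9 ->
  2 * k ^+ 2 / 9 < e * (2 * k - 1) + 2 * g * (1 - k) ^+ 2 + g ^+ 2 / 4 -> False.
Proof.
move=> H k1 k2 e1 HO HX.
have g0 := cp_g0 H.
have e2 := cp_e H.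
pose x := 1/4 - e; pose j := k - 3/4.
have eE : e = 1/4 - x by rewrite /x; lra.
have kE : k = 3/4 + j by rewrite /j; lra.
have j0 : 0 <= j by rewrite /j; lra.
have j1 : j <= 1/4 by rewrite /j; lra.
have x0 : 0 <= x by rewrite /x; lra.
have x1 : x <= 1/36 by rewrite /x; lra.
have bx : b <= 4 * (x + 2 * x ^+ 2) by apply: (profile_b H); rewrite /x; lra.
have gx : g <= 9/2 * x ^+ 2.
  have b0 := cp_b0 H.
  have : b <= 4 * (19/18 * x) by nra.
  by have := cp_g H; nra.
have gs : g <= 1/280 by nra.
rewrite eE kE in HX HO.
have gj : g * (1/4 - j) ^+ 2 <= g * (1/16) by apply: ler_wpM2l => //; nra.
have g2 : g ^+ 2 <= 1/280 * g by rewrite expr2; apply: ler_wpM2r.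
have gx' : g <= 1/8 * x by nra.
have A1 : 2 * x * (1 + 4 * j) < 2/3 * j - 8/9 * j ^+ 2 + 1/2 * g + g ^+ 2 by lra.
have A2 : 2/3 * j + 16/9 * j ^+ 2 < 2 * x + 4 * g + 4 * g ^+ 2 by lra.
have xj0 : 0 <= x * j by exact: mulr_ge0.
have jj0 : 0 <= j ^+ 2 by exact: sqr_ge0.
have xj : x * (1 + 4 * j) <= 7/20 * j by lra.
have gj2 : g * (1 + 4 * j) <= 2205/4000 * j ^+ 2.
  have h1 : g * (1 + 4 * j) <= 9/2 * x ^+ 2 * (1 + 4 * j) by apply: ler_wpM2r => //; clear -j0; lra.
  have h2 : x * (x * (1 + 4 * j)) <= x * (7/20 * j) by exact: ler_wpM2l.
  have h3 : x * j <= 7/20 * j * j by apply: ler_wpM2r => //; lra.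
  lra.
have A3 : (2/3 * j + 16/9 * j ^+ 2) * (1 + 4 * j) < (2 * x + 4 * g + 4 * g ^+ 2) * (1 + 4 * j).
  by rewrite ltr_pM2r //; clear -j0; lra.
have j3 : 0 <= j ^+ 3 by rewrite exprn_ge0.
have g2j : g ^+ 2 * (1 + 4 * j) <= 1/280 * g * (1 + 4 * j).
  by apply: ler_wpM2r => //; clear -j0; lra.
have gj0 : 0 <= g * j by exact: mulr_ge0.
clear -A1 A2 A3 gj2 xj gj0 g2j xj0 jj0 j3 g0 j0 gs g2 gx'; lra.
Qed.

(* An upper bound [X] on [1 / 4 - e] yields the upper bound [gval] on [g] as soon as [tau]
   satisfies [gcond] (see [cubic_bound]); by [xcond] this improves [X] on [[k1, k2]]. After two
   such rounds, [ocond] contradicts the test that vanishes on one side. *)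
Definition gval (R : realFieldType) (A Y tau : R) := 3 * tau ^+ 2 - 8 * A * tau - Y.

Definition gcond (R : realFieldType) (A Y c tau : R) :=
  (2 * A <= tau) &&
  (2 * tau ^+ 2 * (tau - 2 * A)
     <= (3 * tau ^+ 2 - 8 * A * tau - Y - 4 * A ^+ 2) * (1/2 - c)).

Definition xcond (R : realFieldType) (k1 k2 g X : R) :=
  (1/4 - X) * (2 * k2 - 1) + 2 * g * (1 - k1) ^+ 2 + g ^+ 2 / 4 <= 2 * k2 ^+ 2 / 9.

Definition ocond (R : realFieldType) (k1 X g : R) :=
  2 * k1 - 16 * k1 ^+ 2 / 9 <= 1/2 - 2 * X - 4 * g - 4 * g ^+ 2.

Lemma row_low (R : realFieldType) (k e b p t G g k1 k2 X1 t1 X2 t2 : R) :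
  let A1 := X1 + 2 * X1 ^+ 2 in let A2 := X2 + 2 * X2 ^+ 2 in
  cut_profile k e b p t G g -> g <= 163/10000 ->
  2 * e - 4 * g - 4 * g ^+ 2 < 2 * k - 16 * k ^+ 2 / 9 ->
  2 * k ^+ 2 / 9 < e * (2 * k - 1) + 2 * g * (1 - k) ^+ 2 + g ^+ 2 / 4 ->
  k1 <= k -> k <= k2 ->
  [&& 3/4 <= k1, k2 <= 1, 0 <= X1, X1 <= 1/36, 0 <= X2 & X2 <= 1/36] ->
  xcond k1 k2 (163/10000) X1 -> gcond A1 X1 A1 t1 ->
  xcond k1 k2 (gval A1 X1 t1) X2 -> gcond A2 X2 A2 t2 ->
  ocond k1 X2 (gval A2 X2 t2) -> False.
Proof.
move=> A1 A2 H gA HO HX kl kr /and5P[k1l k2l X10 X11 /andP[X20 X21]].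
move=> C1 /andP[B1 D1] C2 /andP[B2 D2] O.
have g0 := cp_g0 H.
have x1 := density_upper kl kr k2l g0 gA X11 HX k1l C1.
have gX1 : g <= gval A1 X1 t1.
  by apply: (profile_g_low H x1) => //; rewrite /A1; clear -X10 X11; nra.
have x2 := density_upper kl kr k2l g0 gX1 X21 HX k1l C2.
have gX2 : g <= gval A2 X2 t2.
  by apply: (profile_g_low H x2) => //; rewrite /A2; clear -X20 X21; nra.
exact: out_contra HO k1l kl g0 gX2 x2 O.
Qed.

Lemma row_high (R : realFieldType) (k e b p t G g k1 k2 X1 t1 X2 t2 : R) :
  let Y1 := X1 - (17/10 - 2 * k2) ^+ 2 in
  let Y2 := X2 - (17/10 - 2 * k2) ^+ 2 in
  cut_profile k e b p t G g -> g <= 163/10000 -> 0 < G ->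
  2 * e - 4 * g - 4 * g ^+ 2 < 2 * k - 16 * k ^+ 2 / 9 ->
  2 * k ^+ 2 / 9 < e * (2 * k - 1) + 2 * g * (1 - k) ^+ 2 + g ^+ 2 / 4 ->
  k1 <= k -> k <= k2 ->
  [&& 3/4 <= k1, k2 <= 85/100, 0 <= X1, X1 <= 1/36, 0 <= X2 & X2 <= 1/36] ->
  xcond k1 k2 (163/10000) X1 -> gcond Y1 Y1 0 t1 ->
  xcond k1 k2 (gval Y1 Y1 t1) X2 ->
  (Y2 < 0) || gcond Y2 Y2 0 t2 && ocond k1 X2 (gval Y2 Y2 t2) -> False.
Proof.
move=> Y1 Y2 H gA G0 HO HX kl kr /and5P[k1l k2l X10 X11 /andP[X20 X21]] C1 /andP[B1 D1] C2.
have g0 := cp_g0 H.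
have k21 : k2 <= 1 by clear -k2l; lra.
have x1 := density_upper kl kr k21 g0 gA X11 HX k1l C1.
have sq := sqr_ge0 (17/10 - 2 * k2).
have gX1 : g <= gval Y1 Y1 t1.
  by apply: (profile_g_high H G0 kr k2l x1) => //; rewrite /Y1; clear -X11 sq; lra.
have x2 := density_upper kl kr k21 g0 gX1 X21 HX k1l C2.
case/orP => [Yn|/andP[/andP[B2 D2] O]].
  (* By the wheel, [Y2] bounds [p * (1 - p) - e], which [cp_y] makes nonnegative. *)
  by have [_] := profile_y H G0 kr k2l x2; have := cp_y H; rewrite -/Y2; clear -Yn; lra.
have gX2 : g <= gval Y2 Y2 t2.
  by apply: (profile_g_high H G0 kr k2l x2) => //; rewrite /Y2; clear -X21 sq; lra.
exact: out_contra HO k1l kl g0 gX2 x2 O.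
Qed.

Lemma cut_profile_contra_low (R : realFieldType) (k e b p t G g : R) :
  cut_profile k e b p t G g -> 1 <= k -> 217/1000 <= e ->
  2 * e - 4 * g - 4 * g ^+ 2 < 2 * k - 16 * k ^+ 2 / 9 -> False.
Proof.
move=> H k1 e1 HO.
have gA : g <= 3/100.
  suff : g <= gval (33/1000 + 2 * (33/1000) ^+ 2) (33/1000) (195/1000) by rewrite /gval; lra.
  by apply: (profile_g_low H) => //; clear -e1; lra.
have := cp_g0 H; nra.
Qed.

Lemma cut_profile_contra (R : realFieldType) (k e b p t G g : R) :
  cut_profile k e b p t G g -> 3/4 <= k -> k <= 1 -> 2/9 <= e ->
  2 * e - 4 * g - 4 * g ^+ 2 < 2 * k - 16 * k ^+ 2 / 9 ->
  2 * k ^+ 2 / 9 < e * (2 * k - 1) + 2 * g * (1 - k) ^+ 2 + g ^+ 2 / 4 -> False.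
Proof.
move=> H kl kr e1 HO HX.
have [G0|G0] : G = 0 \/ 0 < G.
  by have := cp_G0 H; rewrite le_eqVlt => /orP[/eqP|]; auto.
  by rewrite G0 in H; exact: flat_case H _ _ _ HO HX.
have x1 : 1/4 - e <= 1/36 by lra.
have gA : g <= 163/10000.
  suff : g <= gval (1/36 + 2 * (1/36) ^+ 2) (1/36) (1662/10000) by rewrite /gval; lra.
  by apply: (profile_g_low H) => //; lra.
(* In the table below, [X1] and [X2] are in units of [10 ^ -5] and the tangent points in units of
   [10 ^ -4]. Each row covers the [k] between its own threshold and the previous one; the wheel
   serves from [k <= 846/1000] on. *)
have low k1 k2 X1 t1 X2 t2 (kl' : k1 <= k) (kr' : k <= k2) :=
  @row_low _ _ _ _ _ _ _ _ k1 k2 (X1 / 1000 / 100) (t1 / 1000 / 10) (X2 / 1000 / 100)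
    (t2 / 1000 / 10) H gA HO HX kl' kr'.
have high k1 k2 X1 t1 X2 t2 (kl' : k1 <= k) (kr' : k <= k2) :=
  @row_high _ _ _ _ _ _ _ _ k1 k2 (X1 / 1000 / 100) (t1 / 1000 / 10) (X2 / 1000 / 100)
    (t2 / 1000 / 10) H gA G0 HO HX kl' kr'.
have [kl'|{}kr] := leP (885 / 1000) k; last move/ltW in kr.
  by apply: (out_contra HO _ kl' (cp_g0 H) gA x1); clear; lra.
have [kl'|{}kr] := leP (864 / 1000) k; last move/ltW in kr.
  by apply: (low _ _ 2484 1515 2461 1503 kl' kr); clear; rewrite /xcond /gcond /gval /ocond; lra.
have [kl'|{}kr] := leP (853 / 1000) k; last move/ltW in kr.
  by apply: (low _ _ 2320 1433 2280 1413 kl' kr); clear; rewrite /xcond /gcond /gval /ocond; lra.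
have [kl'|{}kr] := leP (846 / 1000) k; last move/ltW in kr.
  by apply: (low _ _ 2217 1383 2166 1357 kl' kr); clear; rewrite /xcond /gcond /gval /ocond; lra.
have [kl'|{}kr] := leP (838 / 1000) k; last move/ltW in kr.
  by apply: (high _ _ 2150 1317 2080 1285 kl' kr); clear; rewrite /xcond /gcond /gval /ocond; lra.
have [kl'|{}kr] := leP (831 / 1000) k; last move/ltW in kr.
  by apply: (high _ _ 2063 1255 1977 1214 kl' kr); clear; rewrite /xcond /gcond /gval /ocond; lra.
have [kl'|{}kr] := leP (824 / 1000) k; last move/ltW in kr.
  by apply: (high _ _ 1982 1177 1876 1128 kl' kr); clear; rewrite /xcond /gcond /gval /ocond; lra.
have [kl'|{}kr] := leP (816 / 1000) k; last move/ltW in kr.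
  by apply: (high _ _ 1897 1079 1765 1016 kl' kr); clear; rewrite /xcond /gcond /gval /ocond; lra.
have [kl'|{}kr] := leP (806 / 1000) k; last move/ltW in kr.
  by apply: (high _ _ 1792 937 1625 856 kl' kr); clear; rewrite /xcond /gcond /gval /ocond; lra.
have [kl'|{}kr] := leP (794 / 1000) k; last move/ltW in kr.
  by apply: (high _ _ 1649 710 1431 592 kl' kr); clear; rewrite /xcond /gcond /gval /ocond; lra.
by apply: (high _ _ 1532 354 1179 354 kl kr); clear; rewrite /xcond /gcond /gval /ocond; lra.
Qed.

Lemma normalized_tests_contra (R : realFieldType) (k e b p t G s1 s2 i1 i2 D : R) :
  cut_profile k e b p t G ((i1 + i2) / 2) -> 3/4 <= k ->
  (k <= 1 -> 2/9 < e) -> (1 <= k -> 217/1000 < e) ->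
  e = D + (i1 + i2) / 2 -> s1 + s2 = 1 -> 0 <= s1 -> 0 <= s2 ->
  0 <= i1 -> 0 <= i2 -> D <= s1 * s2 ->
  (s1 <= k -> s2 <= k ->
     4 * k ^+ 2 / 9 < i1 + 2 * ((k - s1) / (2 * k - 1)) * (s1 - i1 - D)
      + ((k - s1) / (2 * k - 1)) ^+ 2 * (2 * k - 2 + (i1 + i2 + 2 * D))) ->
  (0 < s1 -> 0 < s2 -> s1 <= k -> s2 <= k -> k <= 1 ->
     4 * k ^+ 2 / 9 < i1 + 2 * ((k - s1) / s2) * D + ((k - s1) / s2) ^+ 2 * i2) ->
  (0 < s1 -> 0 < s2 -> s1 <= k -> s2 <= k -> k <= 1 ->
     4 * k ^+ 2 / 9 < i2 + 2 * ((k - s2) / s1) * D + ((k - s2) / s1) ^+ 2 * i1) ->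
  False.
Proof.
move=> H k34 e1 e2 eE s12 s10 s20 i10 i20 Ds Z X1 X2.
have e4 := cp_e H.
have out : s1 <= k -> s2 <= k ->
    2 * e - 4 * ((i1 + i2) / 2) - 4 * ((i1 + i2) / 2) ^+ 2 < 2 * k - 16 * k ^+ 2 / 9.
  move=> s1k s2k.
  have := combine_outside_test k34 s12 i10 i20 _ (Z s1k s2k); rewrite eE in e4 *.
  by move=> /(_ ltac:(clear -e4; lra)); clear; lra.
have [k1|/ltW k1] := leP k 1; last first.
  apply: (cut_profile_contra_low H k1 (ltW (e2 k1))); apply: out; clear -s10 s20 s12 k1; lra.
have e29 := e1 k1.
have gA : (i1 + i2) / 2 <= 163/10000.
  suff : (i1 + i2) / 2 <= gval (1/36 + 2 * (1/36) ^+ 2) (1/36) (1662/10000).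
    by rewrite /gval; clear; lra.
  by apply: (profile_g_low H) => //; clear -e29; lra.
have D5 : 1/5 <= D by clear -gA e29 eE; lra.
have s1p : 0 < s1.
  by rewrite lt0r s10 andbT; apply/eqP => s; move: Ds; rewrite s mul0r; clear -D5; lra.
have s2p : 0 < s2.
  by rewrite lt0r s20 andbT; apply/eqP => s; move: Ds; rewrite s mulr0; clear -D5; lra.
have s2E : s2 = 1 - s1 by clear -s12; lra.
(* [1/5 <= D <= s1 * (1 - s1)] rules out [s1 > 3/4], where the product is below [3/16]. *)
have s1k : s1 <= k by rewrite leNgt; apply/negP => hs; move: Ds; rewrite s2E; clear -D5 hs k34; nra.
have s2k : s2 <= k.
  have s1E : s1 = 1 - s2 by clear -s12; lra.
  by rewrite leNgt; apply/negP => hs; move: Ds; rewrite s1E; clear -D5 hs k34; nra.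
have {}X1 := X1 s1p s2p s1k s2k k1; have {}X2 := X2 s1p s2p s1k s2k k1.
apply: (cut_profile_contra H k34 k1 (ltW e29) (out s1k s2k)).
have tc : 2 * k ^+ 2 / 9 < (D + (i1 + i2) / 2) * (2 * k - 1) + (i1 + i2) * (1 - k) ^+ 2
                   + ((i1 + i2) / 2) ^+ 2 / 4.
  have [s12'|/ltW s21] := leP s1 s2.
    exact: (combine_cut_tests k34 k1 s1p s12' s12 i10 i20 D5 Ds X1 X2).
  rewrite (addrC i1); rewrite mulrC in Ds; rewrite addrC in s12.
  exact: (combine_cut_tests k34 k1 s2p s21 s12 i20 i10 D5 Ds X2 X1).
by rewrite eE; clear -tc; lra.
Qed.

(** * Quadratic forms and edge counts *)

Section Forms.
Variables (R : realFieldType) (T : finType) (G : sgraph T).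
Implicit Types (f g : T -> R) (A B C S U : {set T}).

Definition adjw (x y : T) : R := (G x y)%:R.
Definition deg_in C x : R := \sum_(y in C) adjw x y.
(* Ordered pairs: an edge inside [A] is counted twice in [ed A A]. *)
Definition ed A C : R := \sum_(x in A) deg_in C x.
Definition nbw f x : R := \sum_y adjw x y * f y.
Definition form f g : R := \sum_x f x * nbw g x.
Definition ind A x : R := (x \in A)%:R.

Lemma adjwC x y : adjw x y = adjw y x.
Proof. by rewrite /adjw adj_sym. Qed.

Lemma adjw_ge0 x y : 0 <= adjw x y.
Proof. by rewrite ler0n. Qed.

Lemma adjw_le1 x y : adjw x y <= 1.
Proof. by rewrite /adjw; case: (G x y). Qed.

Lemma formC f g : form f g = form g f.
Proof.
rewrite /form /nbw.
under eq_bigr => x _ do rewrite mulr_sumr.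
under [RHS]eq_bigr => x _ do rewrite mulr_sumr.
rewrite exchange_big; apply: eq_bigr => x _; apply: eq_bigr => y _.
by rewrite adjwC; ring.
Qed.

Lemma formDl f1 f2 g : form (fun x => f1 x + f2 x) g = form f1 g + form f2 g.
Proof. by rewrite -big_split; apply: eq_bigr => x _; rewrite mulrDl. Qed.

Lemma formZl c f g : form (fun x => c * f x) g = c * form f g.
Proof. by rewrite mulr_sumr; apply: eq_bigr => x _; rewrite mulrA. Qed.

Lemma formZr c f g : form f (fun x => c * g x) = c * form f g.
Proof. by rewrite formC formZl formC. Qed.

(** * Rounding a weight to a set *)

Lemma sum_delta (u : T) f : \sum_x (x == u)%:R * f x = f u.
Proof.
rewrite (bigD1 u) //= eqxx mul1r big1 ?addr0 // => x /negPf ->.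
by rewrite mul0r.
Qed.

Lemma sum_deltaB (u v : T) f : \sum_x ((x == u)%:R - (x == v)%:R) * f x = f u - f v.
Proof.
under eq_bigr => x _ do rewrite mulrBl.
by rewrite sumrB !sum_delta.
Qed.

(* The form drops because [u] and [v] span no loops: along [u - v] its second-order term is
   [- 2 * adjw u v]. *)
Lemma shift_mass (u v : T) f :
  u != v -> (forall x, 0 <= f x <= 1) -> 0 < f u < 1 -> 0 < f v < 1 ->
  nbw f u <= nbw f v ->
  exists g, [/\ forall x, 0 <= g x <= 1, \sum_x g x = \sum_x f x,
    form g g <= form f f &
    ([set x | (0 < g x) && (g x < 1)] \proper [set x | (0 < f x) && (f x < 1)])].
Proof.
move=> uv f01 /andP[fu0 fu1] /andP[fv0 fv1] L.
(* The largest admissible shift: after it, [u] has weight [1] or [v] has weight [0]. *)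
pose s := Num.min (1 - f u) (f v).
pose k x : R := (x == u)%:R - (x == v)%:R.
have s0 : 0 < s by rewrite /s lt_min subr_gt0 fu1 fv0.
have su : s <= 1 - f u by rewrite /s ge_min lexx.
have sv : s <= f v by rewrite /s ge_min lexx orbT.
have ku : k u = 1 by rewrite /k eqxx (negPf uv) subr0.
have kv : k v = -1 by rewrite /k eqxx eq_sym (negPf uv) sub0r.
have kE x : x != u -> x != v -> k x = 0 by move=> /negPf xu /negPf xv; rewrite /k xu xv subr0.
pose g x := f x + s * k x.
have gE x : x != u -> x != v -> g x = f x by move=> xu xv; rewrite /g kE // mulr0 addr0.
exists g; split.
- move=> x; have [->|xu] := eqVneq x u; first by rewrite /g ku; apply/andP; split; lra.
  have [->|xv] := eqVneq x v; first by rewrite /g kv; apply/andP; split; lra.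
  by rewrite gE.
- rewrite big_split /= -mulr_sumr.
  have : \sum_x k x = 0.
    have k0 := sum_deltaB u v (fun=> 1); rewrite subrr in k0; rewrite -[RHS]k0.
    by apply: eq_bigr => x _; rewrite mulr1.
  by move->; rewrite mulr0 addr0.
- have formk h : form k h = nbw h u - nbw h v by rewrite /form sum_deltaB.
  have nk x : nbw k x = adjw x u - adjw x v.
    by rewrite /nbw; under eq_bigr => y _ do rewrite mulrC; rewrite sum_deltaB.
  have formg h : form g h = form f h + s * form k h by rewrite -formZl -formDl.
  have -> : form g g = form f f + 2 * s * form k f + s ^+ 2 * form k k.
    by rewrite formg (formC f) (formC k) !formg (formC f k); ring.
  have irr x : adjw x x = 0 by rewrite /adjw adj_irrefl.
  rewrite !formk !nk !irr (adjwC v u).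
  have h1 : 0 <= s * (nbw f v - nbw f u).
    by apply: mulr_ge0; [exact: ltW | rewrite subr_ge0].
  have h2 : 0 <= s ^+ 2 * adjw u v by apply: mulr_ge0; rewrite ?sqr_ge0 ?adjw_ge0.
  lra.
- rewrite properE; apply/andP; split.
    apply/subsetP => x; rewrite !inE.
    have [->|xu] := eqVneq x u; first by rewrite fu0 fu1.
    have [->|xv] := eqVneq x v; first by rewrite fv0 fv1.
    by rewrite gE.
  apply/negP => /subsetP sub.
  have := sub u; have := sub v; rewrite !inE fu0 fu1 fv0 fv1 /g ku kv.
  move=> /(_ isT) /andP[h1 _] /(_ isT) /andP[_ h2].
  have : s = 1 - f u \/ s = f v by rewrite /s minEle; case: ifP; auto.
  by case; lra.
Qed.

Lemma sum_ind A : \sum_x ind A x = #|A|%:R.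
Proof. by rewrite -natr_sum -sum1_card [in RHS]big_mkcond. Qed.

Lemma eq_form f g : f =1 g -> form f f = form g g.
Proof.
move=> fg; apply: eq_bigr => x _; rewrite fg; congr (_ * _).
by apply: eq_bigr => y _; rewrite fg.
Qed.

(** Induction on the number of fractional weights. As the total is an integer, a single fractional
    weight is impossible, so there are always two between which [shift_mass] can act. *)
Lemma rounding f (h : nat) :
  (forall x, 0 <= f x <= 1) -> \sum_x f x = h%:R ->
  exists2 A : {set T}, #|A| = h & form (ind A) (ind A) <= form f f.
Proof.
pose F f := [set x | (0 < f x) && (f x < 1)] : {set T}.
elim: {f}_.+1 {-2}f (ltnSn #|F f|) => // m IH f; rewrite ltnS => Fm f01 fh.
have int01 x : x \notin F f -> f x = (f x == 1)%:R.
  rewrite inE; have /andP[] := f01 x.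
  rewrite !le_eqVlt => /orP[/eqP <- _ _|->]; first by rewrite eq_sym oner_eq0.
  by move=> /orP[/eqP ->|->]//; rewrite eqxx.
have [F0|[u uF]] := set_0Vmem (F f).
  have fE : f =1 ind [set x | f x == 1].
    by move=> x; rewrite {1}int01 ?F0 ?inE // /ind inE.
  exists [set x | f x == 1].
    have fS : \sum_x f x = \sum_x ind [set x | f x == 1] x.
      by apply: eq_bigr => x _; rewrite fE.
    by apply/eqP; rewrite -(eqr_nat R) -fh fS sum_ind.
  by rewrite (eq_form fE).
have [v /andP[vu vF]] : exists v, (v != u) && (v \in F f).
  apply/existsP; apply: contraT; rewrite negb_exists => /forallP int.
  have rest : \sum_(x | x != u) f x = #|[set x | (x != u) && (f x == 1)]|%:R.
    transitivity (\sum_x ind [set x | (x != u) && (f x == 1)] x); last exact: sum_ind.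
    rewrite big_mkcond; apply: eq_bigr => x _; rewrite /ind inE.
    have := int x; have [//|xu /=] := eqVneq x u.
    by move/int01.
  move: fh uF; rewrite (bigD1 u) //= rest inE => fu /andP[fu0 fu1].
  set m' := #|_| in fu.
  have h1 : m'%:R < h%:R :> R by lra.
  have h2 : h%:R < m'.+1%:R :> R by rewrite -addn1 natrD; lra.
  by move: h1 h2; rewrite !ltr_nat ltnS => h1; rewrite leqNgt h1.
have [g [g01 gS gQ gF]] : exists g, [/\ forall x, 0 <= g x <= 1,
    \sum_x g x = \sum_x f x, form g g <= form f f & F g \proper F f].
  move: uF vF; rewrite !inE => uF vF.
  have [L|/ltW L] := leP (nbw f u) (nbw f v).
    by apply: (shift_mass (u := u) (v := v)); rewrite // eq_sym.
  exact: (shift_mass (u := v) (v := u)).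
have [||A cA QA] := IH g _ g01.
- by apply: leq_trans Fm; exact: proper_card.
- by rewrite gS.
by exists A => //; exact: le_trans gQ.
Qed.

(** * Edge counts and three-valued weights *)

Lemma form_ind A C : form (ind A) (ind C) = ed A C.
Proof.
rewrite /form /ed [RHS]big_mkcond; apply: eq_bigr => x _; rewrite /ind.
case: (x \in A); rewrite ?mul0r ?mul1r //.
rewrite /nbw /deg_in [RHS]big_mkcond; apply: eq_bigr => y _.
by case: (y \in C); rewrite ?mulr0 ?mulr1.
Qed.

Lemma edC A C : ed A C = ed C A.
Proof. by rewrite -!form_ind formC. Qed.

Lemma deg_in_ge0 C x : 0 <= deg_in C x.
Proof. by apply: sumr_ge0 => y _; exact: adjw_ge0. Qed.

Lemma ed_ge0 A C : 0 <= ed A C.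
Proof. by apply: sumr_ge0 => y _; exact: deg_in_ge0. Qed.

Lemma deg_in_le C x : deg_in C x <= #|C|%:R.
Proof. by rewrite -sum1_card natr_sum; apply: ler_sum => y _; exact: adjw_le1. Qed.

Lemma deg_in_card C x : deg_in C x = #|[set y in C | G x y]|%:R.
Proof.
rewrite -sum1_card natr_sum /deg_in big_mkcond [RHS]big_mkcond.
by apply: eq_bigr => y _; rewrite inE /adjw; case: (y \in C); case: (G x y).
Qed.

Lemma sum_disjointU A C f : [disjoint A & C] ->
  \sum_(x in A :|: C) f x = \sum_(x in A) f x + \sum_(x in C) f x.
Proof. by move=> AC; rewrite -bigU //; apply: eq_bigl => x; rewrite inE. Qed.

Lemma edUl A B C : [disjoint A & B] -> ed (A :|: B) C = ed A C + ed B C.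
Proof. by move=> AB; rewrite /ed -bigU //; apply: eq_bigl => y; rewrite inE. Qed.

Lemma edUr A B C : [disjoint A & B] -> ed C (A :|: B) = ed C A + ed C B.
Proof. by move=> AB; rewrite !(edC C) edUl. Qed.

Lemma ed_setU A C : [disjoint A & C] ->
  ed (A :|: C) (A :|: C) = ed A A + ed C C + 2 * ed A C.
Proof. by move=> AC; rewrite edUl // !edUr // (edC C A); ring. Qed.

Lemma nbw_cst1 x : nbw (fun=> 1) x = (degree G x)%:R.
Proof.
rewrite /nbw /degree -sum1_card natr_sum [RHS]big_mkcond.
by apply: eq_bigr => y _; rewrite inE /adjw mulr1; case: (G x y).
Qed.

Lemma step_form (d : nat) S1 S2 (a b c : R) :
  (forall x, degree G x = d) ->
  let f x := c * 1 + (a * ind S1 x + b * ind S2 x) in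
  form f f = c ^+ 2 * (d%:R * #|T|%:R) + 2 * c * d%:R * (a * #|S1|%:R + b * #|S2|%:R)
    + a ^+ 2 * ed S1 S1 + b ^+ 2 * ed S2 S2 + 2 * a * b * ed S1 S2.
Proof.
move=> hd f.
have form1 g : form g (fun=> 1) = d%:R * \sum_x g x.
  by rewrite mulr_sumr; apply: eq_bigr => x _; rewrite nbw_cst1 hd mulrC.
have fl h : form f h = c * form (fun=> 1) h + (a * form (ind S1) h + b * form (ind S2) h).
  by rewrite -!formZl -!formDl.
have s1 : \sum_(x : T) (1 : R) = #|T|%:R by rewrite sumr_const cardT.
rewrite fl (formC _ f) (formC (ind S1)) (formC (ind S2)) !fl.
rewrite (formC (fun=> 1) (ind S1)) (formC (fun=> 1) (ind S2)) !form1 !sum_ind s1.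
by rewrite (formC (ind S2) (ind S1)) !form_ind; ring.
Qed.

(** The weight is [a] on [S1], [b] on [S2] and [c] elsewhere. Written as [c] plus multiples of two
    indicators, it involves only the sizes and edge counts of [S1] and [S2], because the degree is
    constant. *)
Lemma step_test (d : nat) S1 S2 (a b c : R) :
  (forall x, degree G x = d) ->
  (forall f, (forall x, 0 <= f x <= 1) -> \sum_x f x = #|T|%:R / 2 ->
     #|T|%:R ^+ 2 / 9 < form f f) ->
  [disjoint S1 & S2] -> 0 <= a <= 1 -> 0 <= b <= 1 -> 0 <= c <= 1 ->
  a * #|S1|%:R + b * #|S2|%:R + c * (#|T|%:R - #|S1|%:R - #|S2|%:R) = #|T|%:R / 2 ->
  #|T|%:R ^+ 2 / 9 <
    c ^+ 2 * (d%:R * #|T|%:R)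
    + 2 * c * d%:R * ((a - c) * #|S1|%:R + (b - c) * #|S2|%:R)
    + (a - c) ^+ 2 * ed S1 S1 + (b - c) ^+ 2 * ed S2 S2
    + 2 * (a - c) * (b - c) * ed S1 S2.
Proof.
move=> hd fail dis a01 b01 c01 sum.
rewrite -step_form //; apply: fail.
  move=> x; rewrite /ind.
  have [x1|_] := boolP (x \in S1); last first.
    by case: (x \in S2); rewrite ?mulr0 ?mulr1 ?add0r ?addr0 // addrC subrK.
  by rewrite (disjointFr dis x1) mulr0 !mulr1 addr0 addrC subrK.
have s1 : \sum_(x : T) (1 : R) = #|T|%:R by rewrite sumr_const cardT.
by rewrite !big_split /= -!mulr_sumr !sum_ind s1 -sum; ring.
Qed.

Lemma sum_card (C : {set T}) (c : R) : \sum_(x in C) c = #|C|%:R * c.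
Proof. by rewrite sumr_const mulr_natl. Qed.

(** * Triangle-free sets *)

Definition triangle_free_in U := forall x y z, x \in U -> y \in U -> z \in U ->
  ~~ [&& G x y, G y z & G x z].

Lemma nbhd_sub U v : [set x in U | G v x] \subset U.
Proof. by apply/subsetP => x; rewrite inE => /andP[]. Qed.

Lemma tf_indep U v C : triangle_free_in U -> v \in U -> C \subset U ->
  ed [set x in C | G v x] [set x in C | G v x] = 0.
Proof.
move=> tf vU /subsetP CU; apply: big1 => x; rewrite inE => /andP[xC vx].
apply: big1 => y; rewrite inE => /andP[yC vy].
have := tf v x y vU (CU x xC) (CU y yC); rewrite vx vy andbT /= /adjw.
by case: (G x y).
Qed.

(** The neighbourhood of [v] is independent, so an edge inside [C] meets it in exactly one end or
    avoids it; the halves undo double counting. *)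
Lemma ed_nbhd U v C : triangle_free_in U -> v \in U -> C \subset U ->
  ed [set x in C | G v x] C =
    ed C C / 2 - ed (C :\: [set x in C | G v x]) (C :\: [set x in C | G v x]) / 2.
Proof.
move=> tf vU CU; set P := [set x in C | G v x].
have PC : P \subset C by exact: nbhd_sub.
have CE : C = P :|: (C :\: P) by rewrite -{1}(setID C P) (setIidPr PC).
have dis : [disjoint P & C :\: P] by rewrite -setI_eq0 setIDA setDIl setDv set0I.
have -> : ed C C = ed P C + ed (C :\: P) C by rewrite {1}CE edUl.
have -> : ed P C = ed (C :\: P) P by rewrite {1}CE edUr // (tf_indep tf vU CU) add0r edC.
have -> : ed (C :\: P) C = ed (C :\: P) P + ed (C :\: P) (C :\: P) by rewrite {2}CE edUr.
by lra.
Qed.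

(* Every edge of a triangle-free graph meets the complement of the neighbourhood [P] of a
   vertex of maximum degree. *)
Lemma furedi_bound U v C (P := [set x in C | G v x]) :
  triangle_free_in U -> v \in U -> C \subset U ->
  (forall x, x \in C -> deg_in C x <= #|P|%:R) ->
  ed C C / 2 + ed (C :\: P) (C :\: P) / 2 <= #|P|%:R * (#|C|%:R - #|P|%:R).
Proof.
move=> tf vU CU maxP.
have PC : P \subset C by exact: nbhd_sub.
have CE : C = P :|: (C :\: P) by rewrite -{1}(setID C P) (setIidPr PC).
have dis : [disjoint P & C :\: P] by rewrite -setI_eq0 setIDA setDIl setDv set0I.
have -> : #|C|%:R - #|P|%:R = #|C :\: P|%:R :> R.
  by rewrite cardsD (setIidPr PC) natrB ?subset_leq_card.
have -> : ed C C / 2 + ed (C :\: P) (C :\: P) / 2 = ed (C :\: P) C.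
  have : ed C C = ed P C + ed (C :\: P) C by rewrite {1}CE edUl.
  by rewrite (ed_nbhd tf vU CU) -/P; lra.
rewrite mulrC -sum_card; apply: ler_sum => x; rewrite inE => /andP[_ xC].
exact: maxP.
Qed.

(** Mantel's theorem, from [furedi_bound] at a vertex of maximum degree. *)
Lemma mantel_bound U C : triangle_free_in U -> C \subset U -> ed C C <= #|C|%:R ^+ 2 / 2.
Proof.
move=> tf CU.
have [->|[x0 x0C]] := set_0Vmem C; first by rewrite /ed big_set0 cards0; lra.
have [v vC vmax] := @arg_maxnP _ x0 (mem C) (fun x => #|[set y in C | G x y]|) x0C.
have := @furedi_bound U v C tf (subsetP CU v vC) CU.
set P := [set x in C | G v x].
have maxP x : x \in C -> deg_in C x <= #|P|%:R.
  by move=> xC; rewrite deg_in_card ler_nat; exact: vmax.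
move=> /(_ maxP); have := ed_ge0 (C :\: P) (C :\: P).
have := sqr_ge0 (#|P|%:R - #|C|%:R / 2 : R); lra.
Qed.

(* For [0 <= m <= M <= p] with [m * M <= t ^+ 2], convexity of [t ^+ 2 / M] bounds [m] by the
   chord through [M = t] and [M = p]. *)
Lemma chord (p t m M : R) : 0 <= m -> m <= M -> M <= p -> 0 <= t -> m * M <= t ^+ 2 ->
  p * m <= t ^+ 2 + t * (p - M).
Proof.
move=> m0 mM Mp t0 mt.
have [tM|Mt] := leP t M; last by nra.
have [M0|M0] := leP M 0; first by nra.
rewrite -(ler_pM2l M0).
have : 0 <= t * ((M - t) * (p - M)) by apply: mulr_ge0 => //; apply: mulr_ge0; lra.
have : 0 <= p * (t ^+ 2 - m * M) by apply: mulr_ge0; lra.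
lra.
Qed.

(** * The cut of a triangle-free set given by an edge *)

Section Cut.
Variables (U : {set T}) (v w : T).
Hypothesis tf : triangle_free_in U.
Hypotheses (vU : v \in U) (wU : w \in U) (vw : G v w).
Let P := [set x in U | G v x].
Let Q := [set x in U | G w x].
Let B := U :\: (P :|: Q).
Let d1 z : R := deg_in P z.
Let d2 z : R := deg_in Q z.
Let mn z : R := Num.min (d1 z) (d2 z).
Let mx z : R := Num.max (d1 z) (d2 z).
Let B1 := [set z in B | d1 z <= d2 z].
Let B2 := [set z in B | ~~ (d1 z <= d2 z)].

Lemma nbhds_disjoint : [disjoint P & Q].
Proof.
rewrite -setI_eq0; apply/eqP/setP => x; rewrite !inE; apply/negP.
move=> /andP[/andP[xU vx] /andP[_ wx]].
by have := tf vU wU xU; rewrite vw vx wx.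
Qed.

Lemma rest_disjoint : [disjoint P :|: Q & B].
Proof. by rewrite -setI_eq0 setIDA setDIl setDv set0I. Qed.

Lemma nbhds_cover : U = (P :|: Q) :|: B.
Proof.
have sub : P :|: Q \subset U by rewrite subUset !nbhd_sub.
by rewrite -[LHS](setID U (P :|: Q)) (setIidPr sub).
Qed.

Lemma rest_split : B = B1 :|: B2.
Proof.
apply/setP => z; rewrite !inE.
by case: (_ <= _); case: (_ \in _); rewrite ?andbT ?andbF ?orbF.
Qed.

Lemma rest_split_disjoint : [disjoint B1 & B2].
Proof.
rewrite -setI_eq0; apply/eqP/setP => x; rewrite !inE.
by case: (_ <= _); rewrite ?andbF.
Qed.

Definition side1 := P :|: B1.
Definition side2 := Q :|: B2.

Lemma side1_disjoint : [disjoint P & B1].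
Proof.
apply: disjointWl (_ : P \subset P :|: Q) _; first exact: subsetUl.
by apply: disjointWr rest_disjoint; rewrite rest_split subsetUl.
Qed.

Lemma side2_disjoint : [disjoint Q & B2].
Proof.
apply: disjointWl (_ : Q \subset P :|: Q) _; first exact: subsetUr.
by apply: disjointWr rest_disjoint; rewrite rest_split subsetUr.
Qed.

Lemma sides_cover : side1 :|: side2 = U.
Proof. by rewrite [RHS]nbhds_cover rest_split /side1 /side2 setUACA. Qed.

Lemma sides_disjoint : [disjoint side1 & side2].
Proof.
rewrite -setI_eq0; apply/eqP/setP => x; rewrite !inE.
have := disjointFr nbhds_disjoint (x := x); rewrite !inE.
case: (x \in U) => //=; rewrite ?andbF //.
by case: (G v x); case: (G w x); case: (_ <= _) => //= /(_ isT).
Qed.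

Lemma nbhd1_indep : ed P P = 0. Proof. exact: tf_indep tf vU (subxx U). Qed.
Lemma nbhd2_indep : ed Q Q = 0. Proof. exact: tf_indep tf wU (subxx U). Qed.

Lemma ed_cut : ed U U = 2 * ed P Q + 2 * ed B P + 2 * ed B Q + ed B B.
Proof.
rewrite {1 2}nbhds_cover !(edUl, edUr) ?nbhds_disjoint ?rest_disjoint // nbhd1_indep nbhd2_indep.
by rewrite (edC Q P) (edC P B) (edC Q B); ring.
Qed.

Lemma ed_rest_le : ed B B <= #|B|%:R ^+ 2 / 2.
Proof. by apply: (mantel_bound tf); rewrite subsetDl. Qed.

(** The number of edges between the rest [B] and [P] or [Q] that the cut leaves inside a side;
    scaled, it is the [G] of [cut_profile]. *)
Definition minority := \sum_(z in U :\: ([set x in U | G v x] :|: [set x in U | G w x]))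
  Num.min (deg_in [set x in U | G v x] z) (deg_in [set x in U | G w x] z).

(** Only minority edges and edges within [B] lie inside a side, and Mantel's theorem bounds the
    latter. *)
Lemma ed_sides_le :
  ed side1 side1 + ed side2 side2 <= 2 * minority + #|B|%:R ^+ 2 / 2.
Proof.
have mE : minority = ed B1 P + ed B2 Q.
  have -> : minority = \sum_(z in B1) mn z + \sum_(z in B2) mn z.
    rewrite -sum_disjointU ?rest_split_disjoint //; apply: eq_bigl => z.
    by rewrite -[in RHS]rest_split.
  have -> : ed B1 P = \sum_(z in B1) mn z.
    by apply: eq_bigr => z; rewrite inE /mn => /andP[_ h]; rewrite min_l.
  have -> // : ed B2 Q = \sum_(z in B2) mn z.
  apply: eq_bigr => z; rewrite inE /mn -ltNge => /andP[_ h].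
  by rewrite min_r // ltW.
have bE : ed B B = ed B1 B1 + 2 * ed B1 B2 + ed B2 B2.
  by rewrite {1 2}rest_split !(edUl, edUr) ?rest_split_disjoint // (edC B2 B1); ring.
have := ed_rest_le; rewrite bE mE /side1 /side2.
rewrite !(edUl, edUr) ?side1_disjoint ?side2_disjoint // nbhd1_indep nbhd2_indep.
by rewrite (edC P B1) (edC Q B2); have := ed_ge0 B1 B2; lra.
Qed.

(* The pairs of neighbours of [z] in [P] and [Q] are not edges. *)
Lemma ed_nbhds_le z : z \in U -> ed P Q <= #|P|%:R * #|Q|%:R - d1 z * d2 z.
Proof.
move=> zU.
have -> : d1 z * d2 z = \sum_(x in P) \sum_(y in Q) adjw z x * adjw z y.
  by rewrite /d1 /deg_in mulr_suml; apply: eq_bigr => x _; rewrite mulr_sumr.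
have -> : #|P|%:R * #|Q|%:R = \sum_(x in P) \sum_(y in Q) (1 : R).
  by under eq_bigr => x _ do rewrite sum_card mulr1; rewrite sum_card.
rewrite -sumrB; apply: ler_sum => x xP; rewrite -sumrB; apply: ler_sum => y yQ.
have xU := subsetP (nbhd_sub U v) x xP; have yU := subsetP (nbhd_sub U w) y yQ.
have := tf zU xU yU; rewrite /adjw.
by case: (G z x); case: (G x y); case: (G z y) => //=; lra.
Qed.

(** Counting the edges of [U] bounds the sum over [B] of the deficits [p - mx z] by
    [y - t ^ 2 + minority + b ^ 2 / 4]. That this sum is nonnegative is the third estimate; summing
    [chord] over [B] gives the fourth. *)
Lemma cut_estimates (t : R) :
  #|Q|%:R <= #|P|%:R :> R -> 0 <= t ->
  (forall z, z \in B -> d1 z * d2 z <= t ^+ 2) ->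
  ed P Q <= #|P|%:R * #|Q|%:R - t ^+ 2 ->
  let p : R := #|P|%:R in let b : R := #|B|%:R in
  let y := p * (#|U|%:R - p) - ed U U / 2 in
  [/\ 0 <= minority, minority <= b * t,
      t ^+ 2 <= y + b ^+ 2 / 4 + minority &
      (p - t) * minority <= t * (b * t + y + b ^+ 2 / 4 - t ^+ 2)].
Proof.
move=> qp t0 prod PQt p b y.
have mn0 z : 0 <= mn z by rewrite le_min !deg_in_ge0.
have mnmx z : mn z <= mx z by rewrite ge_min le_max lexx.
have mxp z : mx z <= p.
  by rewrite ge_max deg_in_le (le_trans (deg_in_le _ _)).
have mm z : mn z * mx z = d1 z * d2 z by rewrite /mn /mx; case: leP => _ //; rewrite mulrC.
have mnt z : z \in B -> mn z <= t.
  move=> zB; rewrite -ler_sqr ?nnegrE // (le_trans _ (prod z zB)) // -mm expr2.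
  exact: ler_wpM2l.
have mE : minority = \sum_(z in B) mn z by [].
have m0 : 0 <= minority by rewrite mE; apply: sumr_ge0 => z _.
have mb : minority <= b * t by rewrite mE /b -sum_card; exact: ler_sum.
have cU : #|U|%:R = p + #|Q|%:R + b.
  have -> : #|U| = (#|P| + #|Q| + #|B|)%N.
    rewrite {1}nbhds_cover !cardsU (disjoint_setI0 rest_disjoint).
    by rewrite (disjoint_setI0 nbhds_disjoint) !cards0 !subn0.
  by rewrite !natrD.
have ch : p * minority <= b * t ^+ 2 + t * \sum_(z in B) (p - mx z).
  rewrite mE !mulr_sumr -sum_card -big_split /=; apply: ler_sum => z zB.
  by apply: chord => //; rewrite mm; exact: prod.
have sE : \sum_(z in B) (p - mx z) = b * p + minority - ed B P - ed B Q.
  have : ed B P + ed B Q = \sum_(z in B) (mn z + mx z).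
    by rewrite -big_split; apply: eq_bigr => z _; rewrite /mn /mx; case: leP => _ //; rewrite addrC.
  by rewrite sumrB sum_card big_split /= -mE => e; lra.
have s0 : 0 <= \sum_(z in B) (p - mx z) by apply: sumr_ge0 => z _; rewrite subr_ge0.
have sB : \sum_(z in B) (p - mx z) <= y - t ^+ 2 + minority + b ^+ 2 / 4.
  by rewrite sE /y cU ed_cut; have := ed_rest_le; rewrite -/b; lra.
split=> //; first by lra.
have := ler_wpM2l t0 sB; lra.
Qed.

End Cut.

(** * Triangles and odd wheels in [K4]-free graphs *)

Lemma K4_free_no (a b c e : T) : K4_free G -> G a b -> G a c -> G a e ->
  G b c -> G b e -> G c e = false.
Proof.
move=> K ab ac ae bc be; apply/negP => ce; apply: K.
pose f := tnth [tuple a; b; c; e].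
have adj i j : i != j -> G (f i) (f j).
  by move: i j => [[|[|[|[|//]]]] ?] [[|[|[|[|//]]]] ?] //= _;
     rewrite /f !(tnth_nth a) //= adj_sym.
exists f; split=> // i j fij; apply/eqP; apply: contraT => /adj.
by rewrite fij adj_irrefl.
Qed.

Lemma K4_free_nbhd u : K4_free G -> triangle_free_in [set x | G u x].
Proof.
move=> K x y z; rewrite !inE => ux uy uz; apply/negP => /and3P[xy yz xz].
by have := K4_free_no K ux uy uz xy xz; rewrite yz.
Qed.

Definition codeg x y := #|[set z in [set t | G x t] | G y z]|.

Lemma codegE x y : codeg x y = (\sum_z (G x z && G y z))%N.
Proof.
rewrite /codeg -sum1_card big_mkcond; apply: eq_bigr => z _.
by rewrite !inE; case: (G x z); case: (G y z).
Qed.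

Lemma degreeE x : degree G x = (\sum_z G x z)%N.
Proof.
rewrite /degree -sum1_card big_mkcond; apply: eq_bigr => z _.
by rewrite !inE; case: (G x z).
Qed.

(** No vertex is adjacent to all of [u], [v] and [w], so each is counted at most twice in the sum of
    their degrees. *)
Lemma triangle_degree (d : nat) u v w : (forall x, degree G x = d) -> K4_free G ->
  G u v -> G u w -> G v w -> (3 * d <= 2 * #|T|)%N.
Proof.
move=> hd K uv uw vw.
have -> : (3 * d = \sum_z (G u z + G v z + G w z))%N.
  by rewrite !big_split /= -!degreeE !hd; ring.
rewrite mulnC -sum_nat_const; apply: leq_sum => z _.
have := K4_free_no K uv uw _ vw; move=> /(_ z).
by case: (G u z) => //; case: (G v z) => //; case: (G w z) => // /(_ isT isT).
Qed.

(* A vertex outside [N(u)] adjacent to [c] vertices of the rim [c1 c2 c3 c4 c5] sees at least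
   [2 * c - 5] rim edges; a vertex of [N(u)] sees none and has [c <= 2]. *)
Lemma wheel (d m : nat) u c1 c2 c3 c4 c5 : (forall x, degree G x = d) -> K4_free G ->
  (forall x y, G x y -> codeg x y <= m)%N ->
  G u c1 -> G u c2 -> G u c3 -> G u c4 -> G u c5 ->
  G c1 c2 -> G c2 c3 -> G c3 c4 -> G c4 c5 -> G c5 c1 ->
  (11 * d <= 5 * #|T| + 5 * m)%N.
Proof.
move=> hd K cm u1 u2 u3 u4 u5 e12 e23 e34 e45 e51.
have sum_le : (\sum_z ((G c1 z + G c2 z + G c3 z + G c4 z + G c5 z) +
      (G c1 z + G c2 z + G c3 z + G c4 z + G c5 z) + G u z) <=
    \sum_z (5 + ((G c1 z && G c2 z) + (G c2 z && G c3 z) + (G c3 z && G c4 z)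
                 + (G c4 z && G c5 z) + (G c5 z && G c1 z))))%N.
  apply: leq_sum => z _.
  have h c c' : G u c -> G u c' -> G c c' -> ~~ [&& G u z, G c z & G c' z].
    move=> uc uc' cc'; apply/negP => /and3P[uz cz c'z].
    by have := K4_free_no K uc uc' uz cc' cz; rewrite c'z.
  move: (h _ _ u1 u2 e12) (h _ _ u2 u3 e23) (h _ _ u3 u4 e34) (h _ _ u4 u5 e45)
    (h _ _ u5 u1 e51).
  by case: (G u z); case: (G c1 z); case: (G c2 z); case: (G c3 z); case: (G c4 z);
     case: (G c5 z).
move: sum_le; rewrite !big_split /= -!degreeE !hd.
rewrite sum_nat_const -!codegE.
have := cm _ _ e12; have := cm _ _ e23; have := cm _ _ e34; have := cm _ _ e45.
have := cm _ _ e51; rewrite -/(#|T|) /=; lia.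
Qed.

End Forms.

(** * Regular graphs with a dense neighbourhood *)

Lemma max_codeg_edge (T : finType) (G : sgraph T) (x0 y0 : T) : G x0 y0 ->
  exists u v, G u v /\ forall x y, G x y -> (codeg G x y <= codeg G u v)%N.
Proof.
move=> xy0; pose e0 := (x0, y0).
have e0P : G e0.1 e0.2 by [].
have [e eP emax] := @arg_maxnP _ e0 (fun e => G e.1 e.2) (fun e => codeg G e.1 e.2) e0P.
by exists e.1, e.2; split=> // x y xy; exact: (emax (x, y)).
Qed.

Lemma dense_contra (R : rcfType) (T : finType) (G : sgraph T) (d : nat) :
  (forall x, degree G x = d) -> K4_free G -> (4 * #|T| < 9 * d)%N ->
  (forall f : T -> R, (forall x, 0 <= f x <= 1) ->
    \sum_x f x = #|T|%:R / 2 -> #|T|%:R ^+ 2 / 9 < form G f f) -> False.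
Proof.
move=> hd K dense fail.
have [x0 x0T] : exists x0 : T, x0 \in T.
  have [x _|T0] := pickP (mem T); first by exists x.
  have T0' : #|T| = 0%N by apply: eq_card0.
  have h1 (x : T) : 0 <= (0 : R) <= 1 by rewrite lexx ler01.
  have h2 : \sum_(x : T) (0 : R) = #|T|%:R / 2 by rewrite big1 // T0' mul0r.
  have := fail (fun=> 0) h1 h2; rewrite T0' expr0n mul0r /form big1 ?ltxx // => x _.
  by rewrite mul0r.
have d0 : (0 < d)%N by lia.
have [y0 xy0] : exists y, G x0 y.
  have : (0 < #|[set y | G x0 y]|)%N by rewrite -/(degree G x0) hd.
  by rewrite card_gt0 => /set0Pn[y]; rewrite inE => ?; exists y.
have [u [v [uv cmax]]] := max_codeg_edge xy0.
pose U := [set x | G u x].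
pose P := [set x in U | G v x].
have tf : triangle_free_in G U by exact: K4_free_nbhd.
have vU : v \in U by rewrite inE.
pose D : R := d%:R; pose n : R := #|T|%:R; pose E : R := ed R G U U.
have D0 : 0 < D by rewrite ltr0n.
have cU : #|U| = d by rewrite -(hd u).
have dense' : 4 * n < 9 * D by rewrite -!natrM ltr_nat.
(* The choice of the edge [u v] makes [v] a vertex of maximum degree inside [U]. *)
have Pmax x : x \in U -> deg_in R G U x <= #|P|%:R.
  by move=> xU; rewrite deg_in_card ler_nat; apply: cmax; rewrite inE in xU.
have dn : (d < #|T|)%N.
  rewrite -cU -[#|T|]cardsT; apply: proper_card; apply/properP; split; first exact: subsetT.
  by exists u; rewrite !inE ?adj_irrefl.
have Dn : D < n by rewrite ltr_nat.
pose p : R := #|P|%:R.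
have fur := furedi_bound tf vU (subxx U) Pmax; rewrite cU -/P -/E -/D -/p in fur.
have UP0 := ed_ge0 R G (U :\: P) (U :\: P).
pose k : R := n / (2 * D).
have kE : n = 2 * k * D by rewrite /k; field; exact: lt0r_neq0.
have k98 : k < 9/8.
  by rewrite -(ltr_pM2r D0); lra.
have k12 : 1/2 < k by rewrite -(ltr_pM2r D0); lra.
pose e : R := E / (2 * D ^+ 2).
have EE : E = 2 * e * D ^+ 2 by rewrite /e; field; rewrite lt0r_neq0.
clearbody k e.
have D2 : 0 < D ^+ 2 by rewrite exprn_gt0.
have U0 : [disjoint U & set0] by rewrite -setI_eq0 setI0.
have c00 : 0 <= (0 : R) <= 1 by rewrite lexx ler01.
have c11 : 0 <= (1 : R) <= 1 by rewrite lexx ler01.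
have edU0 : ed R G U set0 = 0 by apply: big1 => x _; rewrite /deg_in big_set0.
have ed00 : ed R G set0 set0 = 0 by rewrite /ed big_set0.
(* Tested with the weight [k] on [U] and [0] outside, of mass [k * D = n / 2]. *)
have e1 : k <= 1 -> 2/9 < e.
  move=> k1.
  have ck : 0 <= k <= 1 by apply/andP; split; lra.
  have := step_test hd fail U0 ck c00 c00; rewrite cU cards0 -/n -/D edU0 ed00.
  move=> /(_ ltac:(rewrite kE; lra)); rewrite -/E !subr0 EE kE => h.
  have k0 : 0 < k ^+ 2 * D ^+ 2 by rewrite mulr_gt0 // exprn_gt0; lra.
  by rewrite -(ltr_pM2r k0); clear -h; lra.
have k21 : 0 < 2 * k - 1 by lra.
have k210 : 2 * k - 1 != 0 by rewrite lt0r_neq0.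
have e2 : 1 <= k -> 217/1000 < e.
  move=> k1.
  have cr : 0 <= (k - 1) / (2 * k - 1) <= 1.
    by rewrite divr_ge0 ?ler_pdivrMr //; lra.
  have := step_test hd fail U0 c11 c00 cr; rewrite cU cards0 -/n -/D edU0 ed00.
  move=> /(_ ltac:(rewrite kE; field; exact: k210)); rewrite -/E EE kE => h.
  apply: (sparse_nbhd k1 (ltW k98)).
  by rewrite -(ltr_pM2r D2); clear -h; lra.
have e0 : 0 < e.
  by have [/e1 h|/ltW/e2 h] := leP k 1; clear -h; lra.
have k0 : 0 <= k by clear -k12; lra.
have E0 : 0 < E by rewrite EE mulr_gt0 // mulr_gt0.
have p0 : 0 < p.
  rewrite lt0r ler0n andbT; apply/eqP => p0; move: fur; rewrite p0 mul0r.
  by clear -UP0 E0; lra.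
have [w0 w0P] : exists w, w \in P.
  by apply/set0Pn; rewrite -card_gt0 -(ltr0n R).
have [w wP wmax] := @arg_maxnP _ w0 (mem P) (fun x => #|[set y in U | G x y]|) w0P.
have /andP[wU vw] : (w \in U) && G v w by move: (wP : w \in P); rewrite !inE.
have uw : G u w by move: wU; rewrite inE.
pose Q := [set x in U | G w x].
pose q : R := #|Q|%:R.
have qp : q <= p by rewrite /q -deg_in_card; exact: Pmax.
pose B := U :\: (P :|: Q).
pose b : R := #|B|%:R.
have PQ0 : [disjoint P & Q] by exact: (nbhds_disjoint tf vU wU vw).
have bE : b = D - p - q.
  have : #|U| = (#|P :|: Q| + #|B|)%N.
    by rewrite -(cardsID (P :|: Q) U) (setIidPr _) // subUset (nbhd_sub G U v) (nbhd_sub G U w).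
  rewrite cardsU (disjoint_setI0 PQ0) cards0 subn0 cU /b /D /p /q => ->.
  by rewrite !natrD; ring.
(* By the choice of [w], at most [p * q] edges leave [P]; [fur] bounds the edges avoiding [P]. *)
have bp : b * p <= 2 * (p * (D - p) - E / 2).
  have nb := ed_nbhd R tf vU (subxx U); rewrite -/P -/E in nb.
  have : ed R G P U <= p * q.
    rewrite /p -sum_card; apply: ler_sum => x xP.
    by rewrite deg_in_card /q ler_nat; exact: wmax.
  by rewrite nb bE; clear -fur; lra.
have k34 : 3/4 <= k.
  have := triangle_degree hd K uv uw vw; rewrite -(ler_nat R) !natrM -/D -/n kE => h.
  by rewrite -(ler_pM2r D0); clear -h; lra.
pose d1 z : R := deg_in R G P z.
pose d2 z : R := deg_in R G Q z.
have dd0 z : 0 <= d1 z * d2 z by rewrite mulr_ge0 // deg_in_ge0.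
(* [t ^ 2] is the maximum of [d1 z * d2 z] over [B], or [0] if [B] is empty; the square root
   requires a real closed field. *)
have [t [t0 tB tPQ]] : exists t : R, [/\ 0 <= t, forall z, z \in B -> d1 z * d2 z <= t ^+ 2
    & ed R G P Q <= p * q - t ^+ 2].
  have [B0|[z0 z0B]] := set_0Vmem B.
    exists 0; rewrite lexx expr0n subr0; split=> // [z|]; first by rewrite B0 inE.
    have := ed_nbhds_le R v w tf wU; rewrite -/P -/Q -/(d1 w) -/(d2 w) -/p -/q.
    by have := dd0 w; clear; lra.
  have [z zB zmax] := Order.TotalTheory.arg_maxP (fun z => d1 z * d2 z) z0B.
  exists (Num.sqrt (d1 z * d2 z)); rewrite sqr_sqrtr // sqrtr_ge0; split=> //.
  apply: ed_nbhds_le => //.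
  by have : z \in B := zB; rewrite in_setD => /andP[].
have [m0 mb tm pm] := cut_estimates tf vU wU vw qp t0 tB tPQ.
pose S1 := side1 R G U v w; pose S2 := side2 R G U v w.
have S12 : [disjoint S1 & S2] by exact: sides_disjoint.
have SU : S1 :|: S2 = U by exact: sides_cover.
have inner := ed_sides_le R tf vU wU.
rewrite -/P -/Q -/B -/S1 -/S2 -/b in inner mb tm pm.
rewrite cU -/p -/D -/E in tm pm.
pose m : R := minority R G U v w.
rewrite -/m in m0 mb tm pm inner.
(* A minority edge yields [z] in [B] with neighbours [x] in [P] and [y] in [Q]; then [v x z y w] is
   the rim of a wheel centred at [u]. *)
have mwheel : 0 < m -> 11 * D <= 5 * n + 5 * p.
  move=> mp; have [z zB zm] : exists2 z, z \in B & 0 < Num.min (d1 z) (d2 z).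
    apply/exists_inP; apply: contraLR mp => /exists_inPn h.
    rewrite -leNgt; apply: sumr_le0 => z zB; rewrite leNgt; exact: h.
  have nb (C : {set T}) : 0 < deg_in R G C z -> exists2 x, x \in C & G z x.
    rewrite deg_in_card ltr0n card_gt0 => /set0Pn[x].
    by rewrite inE => /andP[xC zx]; exists x.
  move: zm; rewrite lt_min => /andP[/nb[x xP zx] /nb[y yQ zy]].
  have uz : G u z by move: zB; rewrite !inE => /andP[].
  have /andP[ux vx] : G u x && G v x by move: xP; rewrite !inE.
  have /andP[uy wy] : G u y && G w y by move: yQ; rewrite !inE.
  rewrite -!natrM -natrD ler_nat.
  by apply: (wheel hd K cmax uv ux uz uy uw vx) => //; rewrite adj_sym.
pose s1 : R := #|S1|%:R; pose s2 : R := #|S2|%:R.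
pose i1 := ed R G S1 S1; pose i2 := ed R G S2 S2; pose X := ed R G S1 S2.
have EX : E = i1 + i2 + 2 * X.
  by rewrite /E -SU ed_setU.
have s12 : s1 + s2 = D.
  by rewrite /D -cU -SU cardsU (disjoint_setI0 S12) cards0 subn0 natrD.
have i10 : 0 <= i1 by exact: ed_ge0.
have i20 : 0 <= i2 by exact: ed_ge0.
have s10 : 0 <= s1 by rewrite ler0n.
have s20 : 0 <= s2 by rewrite ler0n.
have Xs : X <= s1 * s2.
  by rewrite /s1 -sum_card; apply: ler_sum => x _; exact: deg_in_le.
have Ep : E <= D * p.
  by rewrite /D -cU -sum_card; apply: ler_sum => x xU; exact: Pmax.
have pD : p <= D by rewrite /p ler_nat -cU subset_leq_card // (nbhd_sub G U v).
have b0 : 0 <= b by rewrite ler0n.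
have test a1 a2 a3 (a01 : 0 <= a1 <= 1) (a02 : 0 <= a2 <= 1) (a03 : 0 <= a3 <= 1) :=
  step_test hd fail S12 a01 a02 a03.
rewrite -/n -/s1 -/s2 -/D -/i1 -/i2 -/X in test.
rewrite -/i1 -/i2 in inner.
clearbody m b p s1 s2 i1 i2 X E.
clear -R D0 kE EE k98 k12 k34 e1 e2 fur UP0 Ep pD b0 bp t0 m0 mb tm pm inner mwheel EX s12
  i10 i20 s10 s20 Xs test.
clearbody D n.
have D0' : D != 0 by rewrite lt0r_neq0.
(* Only numbers remain: sizes are divided by [D] and edge counts by [D ^ 2]. *)
have scale x : exists y, x = y * D by exists (x / D); rewrite divfK.
have scale2 x : exists y, x = y * D ^+ 2 by exists (x / D ^+ 2); rewrite divfK // expf_neq0.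
have [b' ?] := scale b; have [p' ?] := scale p; have [t' ?] := scale t.
have [s1' ?] := scale s1; have [s2' ?] := scale s2; have [m' ?] := scale2 m.
have [i1' ?] := scale2 i1; have [i2' ?] := scale2 i2; have [X' ?] := scale2 X.
subst b p t s1 s2 m i1 i2 X E n; clear scale scale2.
have D2 : 0 < D ^+ 2 by rewrite exprn_gt0.
have D3 : 0 < D ^+ 3 by rewrite exprn_gt0.
have le1 x y : x * D <= y * D -> x <= y by rewrite ler_pM2r.
have le2 x y : x * D ^+ 2 <= y * D ^+ 2 -> x <= y by rewrite ler_pM2r.
have le3 x y : x * D ^+ 3 <= y * D ^+ 3 -> x <= y by rewrite ler_pM2r.
have lt2 x y : x * D ^+ 2 < y * D ^+ 2 -> x < y by rewrite ltr_pM2r.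
have eE : e = X' + (i1' + i2') / 2.
  have : e * D ^+ 2 = (X' + (i1' + i2') / 2) * D ^+ 2 by clear -EX; lra.
  by move/mulIf; apply; rewrite lt0r_neq0.
have s12' : s1' + s2' = 1.
  have : (s1' + s2') * D = 1 * D by clear -s12; lra.
  by move/mulIf; apply.
have s10' : 0 <= s1' by apply: le1; rewrite mul0r.
have s20' : 0 <= s2' by apply: le1; rewrite mul0r.
have i10' : 0 <= i1' by apply: le2; rewrite mul0r.
have i20' : 0 <= i2' by apply: le2; rewrite mul0r.
have b0' : 0 <= b' by apply: le1; rewrite mul0r.
have t0' : 0 <= t' by apply: le1; rewrite mul0r.
have m0' : 0 <= m' by apply: le2; rewrite mul0r.
have Xs' : X' <= s1' * s2' by apply: le2; clear -Xs; lra.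
have y0 : e <= p' * (1 - p') by apply: le2; clear -fur UP0; lra.
have prof : cut_profile k e b' p' t' m' ((i1' + i2') / 2).
  split=> //.
  - by have := sqr_ge0 (p' - 1 / 2); clear -y0; lra.
  - by apply: le2; clear -Ep; lra.
  - by apply: le1; clear -pD; lra.
  - by apply: le2; clear -bp; lra.
  - by apply: le2; clear -mb; lra.
  - by apply: le2; clear -tm; lra.
  - by apply: le3; clear -pm; lra.
  - by clear -i10' i20'; lra.
  - by apply: le2; clear -inner; lra.
  - move=> mp; apply: le1.
    have mp' : 0 < m' * D ^+ 2 by rewrite mulr_gt0.
    by have := mwheel mp'; clear; lra.
have c00 : 0 <= (0 : R) <= 1 by rewrite lexx ler01.
have c11 : 0 <= (1 : R) <= 1 by rewrite lexx ler01.
have k0 : 0 < 2 * k - 1 by clear -k12; lra.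
have k0' : 2 * k - 1 != 0 by rewrite lt0r_neq0.
apply: (normalized_tests_contra prof k34 e1 e2 eE s12' s10' s20' i10' i20' Xs').
- move=> s1k s2k.
  have cr : 0 <= (k - s1') / (2 * k - 1) <= 1.
    by rewrite divr_ge0 ?ler_pdivrMr //; clear -s1k s2k k0 s12'; lra.
  have s2E : s2' = 1 - s1' by clear -s12'; lra.
  have := test _ _ _ c11 c00 cr; move=> /(_ ltac:(rewrite s2E; field; exact: k0')) h.
  apply: lt2; move: h; rewrite s2E; set r := (k - s1') / _; clear; lra.
- move=> s1p s2p s1k s2k k1.
  have cr : 0 <= (k - s1') / s2' <= 1.
    by rewrite divr_ge0 ?ler_pdivrMr //; clear -s1k s2k s12' k1 s2p; lra.
  have s2n : s2' != 0 by rewrite lt0r_neq0.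
  have := test _ _ _ c11 cr c00; move=> /(_ ltac:(field; exact: s2n)) h.
  by apply: lt2; move: h; set r := (k - s1') / _; clear; lra.
- move=> s1p s2p s1k s2k k1.
  have cr : 0 <= (k - s2') / s1' <= 1.
    by rewrite divr_ge0 ?ler_pdivrMr //; clear -s1k s2k s12' k1 s1p; lra.
  have s1n : s1' != 0 by rewrite lt0r_neq0.
  have := test _ _ _ cr c11 c00; move=> /(_ ltac:(field; exact: s1n)) h.
  by apply: lt2; move: h; set r := (k - s2') / _; clear; lra.
Qed.

(** * Balanced bipartitions *)

Lemma edges_inside_count (T : finType) (G : sgraph T) (A : {set T}) :
  (2 * #|edges_inside G A| <= \sum_(x in A) #|[set y in A | G x y]|)%N.
Proof.
have edgeP (F : {set T}) : F \in edges_inside G A ->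
    exists x y, [/\ x \in A, y \in A, G x y & F = [set x; y]].
  rewrite !inE => /andP[/existsP[x /existsP[y /andP[xy /eqP ->]]] sub].
  by exists x, y; split=> //; apply: (subsetP sub); rewrite !inE eqxx ?orbT.
have -> : (2 * #|edges_inside G A| =
    \sum_(F in edges_inside G A) \sum_(x in A) (x \in F : nat))%N.
  rewrite mulnC -sum_nat_const; apply: eq_bigr => F /edgeP[x [y [xA yA xy ->]]].
  have xny : x != y by apply: contraTneq xy => ->; rewrite adj_irrefl.
  transitivity #|[set x; y]|; first by rewrite cards2 xny.
  rewrite -sum1_card big_mkcond [RHS]big_mkcond; apply: eq_bigr => z _.
  rewrite !inE; have [->|zx] := eqVneq z x; first by rewrite xA.
  have [->|zy] := eqVneq z y; first by rewrite yA.
  by case: (z \in A).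
rewrite exchange_big; apply: leq_sum => x xA.
have -> : (\sum_(F in edges_inside G A) (x \in F : nat) =
    #|[set F in edges_inside G A | x \in F]|)%N.
  rewrite -sum1_card big_mkcond [RHS]big_mkcond; apply: eq_bigr => F _.
  by rewrite !inE; case: (_ && _) => //=; case: (x \in F).
apply: leq_trans (leq_imset_card (fun y => [set x; y]) _).
apply: subset_leq_card; apply/subsetP => F; rewrite inE => /andP[/edgeP[a [c [aA cA ac ->]]]].
rewrite !inE => /orP[] /eqP xE; apply/imsetP.
  by exists c; rewrite ?inE ?cA ?xE.
by exists a; rewrite ?inE ?aA ?xE 1?adj_sym // setUC.
Qed.

(** Both halves have the same degree sum and share the crossing edges. *)
Lemma ed_setC (R : realFieldType) (T : finType) (G : sgraph T) (d : nat) (A : {set T}) :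
  (forall x, degree G x = d) -> #|A| = #|~: A| -> ed R G (~: A) (~: A) = ed R G A A.
Proof.
move=> hd cA.
have total C : ed R G C setT = #|C|%:R * d%:R.
  rewrite -sum_card; apply: eq_bigr => x _; rewrite deg_in_card -(hd x) /degree.
  by congr _%:R; apply: eq_card => y; rewrite !inE.
have dis : [disjoint A & ~: A] by rewrite -setI_eq0 setICr.
have := total A; have := total (~: A).
rewrite -cA -(setUCr A) !(edUr _ _ _ dis) (edC _ _ (~: A) A); lra.
Qed.

(** [ed A A] counts the edges inside [A] twice, which pays once for each half. *)
Lemma edges_inside_halves (R : realFieldType) (T : finType) (G : sgraph T) (d : nat)
    (A : {set T}) :
  (forall x, degree G x = d) -> #|A| = #|~: A| ->
  #|edges_inside G A :|: edges_inside G (~: A)|%:R <= ed R G A A.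
Proof.
move=> hd cA.
have count C : 2 * #|edges_inside G C|%:R <= ed R G C C.
  have := edges_inside_count G C; rewrite -(ler_nat R) natrM natr_sum.
  by under eq_bigr => x _ do rewrite -deg_in_card.
have := count A; have := count (~: A); rewrite (ed_setC R hd cA).
have : #|edges_inside G A :|: edges_inside G (~: A)|%:R <=
    #|edges_inside G A|%:R + #|edges_inside G (~: A)|%:R :> R.
  by rewrite -natrD ler_nat cardsU leq_subr.
lra.
Qed.

Lemma sparse_half (T : finType) (G : sgraph T) (d h : nat) :
  (forall x, degree G x = d) -> K4_free G -> #|T| = h.*2 ->
  exists2 A : {set T}, #|A| = h & ed realalg G A A <= #|T|%:R ^+ 2 / 9.
Proof.
move=> hd K cT.
have hT : #|T|%:R / 2 = h%:R :> realalg.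
  by rewrite cT -mul2n natrM mulrC mulKf // pnatr_eq0.
have [/existsP[A /andP[/eqP cA le]]|nex] :=
    boolP [exists A : {set T}, (#|A| == h) && (ed realalg G A A <= #|T|%:R ^+ 2 / 9)].
  by exists A.
have fail (f : T -> realalg) : (forall x, 0 <= f x <= 1) ->
    \sum_x f x = #|T|%:R / 2 -> #|T|%:R ^+ 2 / 9 < form G f f.
  rewrite hT => f01 fh; rewrite ltNge; apply: contra nex => le.
  have [A cA Af] := rounding G f01 fh.
  by apply/existsP; exists A; rewrite cA eqxx -form_ind (le_trans Af).
have [dense|sparse] := ltnP (4 * #|T|) (9 * d).
  by have := dense_contra hd K dense fail.
(* When [9 * d <= 4 * n], the constant weight [1/2] has form [d * n / 4 <= n ^ 2 / 9]. *)
have h01 (x : T) : 0 <= (1/2 : realalg) <= 1 by apply/andP; split; lra.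
have hS : \sum_(x : T) (1/2 : realalg) = #|T|%:R / 2.
  by rewrite -[#|T|]sum1_card natr_sum mulr_suml; apply: eq_bigr.
have := fail (fun=> 1/2) h01 hS.
have -> : form G (fun=> 1/2) (fun=> 1/2) = d%:R * #|T|%:R / 4 :> realalg.
  have -> : (fun=> 1/2) = (fun=> 1/2 * 1) :> (T -> realalg) by rewrite mulr1.
  rewrite formZl formZr /form; under eq_bigr => x _ do rewrite nbw_cst1 hd.
  by rewrite mul1r sumr_const cardT -mulr_natl; field.
have n0 : 0 <= #|T|%:R :> realalg by rewrite ler0n.
have sp : 9 * d%:R <= 4 * #|T|%:R :> realalg by rewrite -!natrM ler_nat.
have := ler_wpM2r n0 sp; clear; lra.
Qed.

Theorem corollary1p4 (n : nat) (n_even : ~~ odd n)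
    (T : finType) (card_T : #|T| = n) (G : sgraph T)
    (G_regular : regular G) (G_K4_free : K4_free G) :
  exists A B : {set T},
    [/\ A :|: B = [set: T], [disjoint A & B],
        #|A| = n./2, #|B| = n./2
      & ((#|edges_inside G A :|: edges_inside G B|)%:R
           <= (n%:R ^+ 2) / 9%:R :> rat)%R].
Proof.
have [d hd] := G_regular.
have nE : n = n./2.*2 by rewrite -[LHS]odd_double_half (negPf n_even).
have [A cA edA] := sparse_half hd G_K4_free (etrans card_T nE).
have cC : #|~: A| = n./2.
  by have := cardsC A; rewrite card_T cA {2}nE -addnn => /addnI.
exists A, (~: A); split=> //; first exact: setUCr.
  by rewrite -setI_eq0 setICr.
have le := le_trans (edges_inside_halves realalg hd (etrans cA (esym cC))) edA.
(* Cleared of denominators, the bound compares natural numbers and so passes from [realalg] to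
   [rat]. *)
move: le; rewrite card_T !ler_pdivlMr ?ltr0n // -!natrX -!natrM.
by rewrite !ler_nat.
Qed.
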